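(* Let $2\le r<m\le n$ and $k\ge2$. Then the variety $\mathcal Z^{m,n}_{r,k}$ is not normal, and, unless possibly $(m,n)=(r+1,r+2)$, it is not Cohen–Macaulay (its coordinate ring is not Cohen–Macaulay).
   Context: Let $F$ be an algebraically closed field. For integers $1\le r\le m\le n$ and $k\ge 1$, let $S=F[x^{(l)}_{i,j}:1\le i\le m,\ 1\le j\le n,\ 0\le l\le k-1]$, the coordinate ring of $\mathbf A^{mnk}_F$, and let $X(t)$ be the $m\times n$ matrix over $S[t]/(t^k)$ with $(i,j)$ entry $x_{i,j}(t)=\sum_{l=0}^{k-1}x^{(l)}_{i,j}t^l$. $\mathcal I^{m,n}_{r,k}\subseteq S$ is the ideal generated by the coefficients of $t^l$, $0\le l\le k-1$, of all $r\times r$ minors of $X(t)$, and $\mathcal Z^{m,n}_{r,k}\subseteq\mathbf A^{mnk}_F$ is its zero set. *)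

(* Defs.v *)
From HB Require Import structures.
From mathcomp Require Import all_boot all_order all_algebra.
From mathcomp Require Import mpoly.
Set Implicit Arguments. Unset Strict Implicit. Unset Printing Implicit Defensive.
Import Order.TTheory GRing.Theory Num.Theory.
Local Open Scope ring_scope.

(* Ideals are predicates R -> Prop.  J is the ideal defining A = R/J.        *)

Definition is_ideal (R : comNzRingType) (P : R -> Prop) : Prop :=
  [/\ P 0, (forall x y, P x -> P y -> P (x + y)) & (forall a x, P x -> P (a * x))].

(* primes of R containing J  <->  primes of A = R/J *)
Definition prime_over (R : comNzRingType) (J P : R -> Prop) : Prop :=
  [/\ is_ideal P, (forall x, J x -> P x), ~ P 1
    & (forall a b, P (a * b) -> P a \/ P b)].

Definition maximal_over (R : comNzRingType) (J M : R -> Prop) : Prop :=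
  prime_over J M /\
  forall Q : R -> Prop, is_ideal Q -> (forall x, M x -> Q x) -> ~ Q 1 ->
    forall x, Q x -> M x.

Definition in_ideal_gen (R : comNzRingType) (J : R -> Prop) (s : seq R) (x : R) : Prop :=
  exists c : 'I_(size s) -> R, J (x - \sum_(i < size s) c i * s`_i).

(* s is a regular sequence on the local ring A_M, with all elements in M A_M
   (elements of M A_M are, up to units of A_M, images of elements of M).
   Membership of y in the ideal (J + (s_<i)) A_M, pulled back to R, means
   u * y in J + (s_<i) for some u outside M. *)
Definition loc_regular_seq (R : comNzRingType) (J M : R -> Prop) (s : seq R) : Prop :=
  (forall i, (i < size s)%N -> M s`_i) /\
  ~ (exists u, ~ M u /\ in_ideal_gen J s u) /\
  forall i, (i < size s)%N -> forall y : R,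
    (exists u, ~ M u /\ in_ideal_gen J (take i s) (u * (s`_i * y))) ->
    (exists u, ~ M u /\ in_ideal_gen J (take i s) (u * y)).

(* a chain P_0 < P_1 < ... < P_h = M of primes of A contained in M,
   i.e. a chain of primes of A_M of length h ending at its maximal ideal *)
Definition prime_chain_to (R : comNzRingType) (J M : R -> Prop)
    (c : nat -> R -> Prop) (h : nat) : Prop :=
  (forall i, (i <= h)%N -> prime_over J (c i)) /\
  (forall i, (i < h)%N ->
     (forall x, c i x -> c i.+1 x) /\ exists x, c i.+1 x /\ ~ c i x) /\
  (forall x, c h x <-> M x).

(* A_M is Cohen--Macaulay: depth A_M = dim A_M (both as suprema) *)
Definition CM_at (R : comNzRingType) (J M : R -> Prop) : Prop :=
  exists d : nat,
    [/\ (exists s, size s = d /\ loc_regular_seq J M s),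
        (forall s, loc_regular_seq J M s -> (size s <= d)%N),
        (exists c, prime_chain_to J M c d)
      & (forall c h, prime_chain_to J M c h -> (h <= d)%N)].

Definition CohenMacaulay (R : comNzRingType) (J : R -> Prop) : Prop :=
  forall M, maximal_over J M -> CM_at J M.

(* A_P is an integrally closed domain (P a prime of R containing J).
   a/s in A_P is zero iff u * a in J for some u outside P. *)
Definition loc_zero (R : comNzRingType) (J P : R -> Prop) (a : R) : Prop :=
  exists u, ~ P u /\ J (u * a).

Definition loc_normal_domain (R : comNzRingType) (J P : R -> Prop) : Prop :=
  ~ loc_zero J P 1 /\
  (forall a b, loc_zero J P (a * b) -> loc_zero J P a \/ loc_zero J P b) /\
  (* integrally closed in its field of fractions: if a/b (b <> 0) satisfies
     x^(d+1) + sum_{i<=d} (p_i/t) x^(d-i) = 0 in Frac(A_P), then a/b in A_P *)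
  (forall a b : R, ~ loc_zero J P b ->
     forall (d : nat) (p : 'I_d.+1 -> R) (t : R), ~ P t ->
       loc_zero J P (t * a ^+ d.+1 +
                     \sum_(i < d.+1) p i * a ^+ (d - i) * b ^+ i.+1) ->
       exists q w, ~ P w /\ loc_zero J P (w * a - q * b)).

Definition normal_ring (R : comNzRingType) (J : R -> Prop) : Prop :=
  forall P, prime_over J P -> loc_normal_domain J P.

Definition nvars (m n k : nat) : nat := #|{: 'I_m * 'I_n * 'I_k}|.

Definition xvar (F : closedFieldType) (m n k : nat) (i : 'I_m) (j : 'I_n) (l : 'I_k)
  : {mpoly F[nvars m n k]} := 'X_(enum_rank (i, j, l)).

Definition Xt (F : closedFieldType) (m n k : nat)
  : 'M[{poly {mpoly F[nvars m n k]}}]_(m, n) :=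
  \matrix_(i, j) \sum_(l < k) (xvar F i j l)%:P * 'X^l.

(* generators of I^{m,n}_{r,k}: coefficients of t^l, l < k, of all r x r minors
   (the coefficients of t^l, l<k, are the same in S[t] and S[t]/(t^k)) *)
Definition minor_coeff_gen (F : closedFieldType) (m n r k : nat)
    (p : {mpoly F[nvars m n k]}) : Prop :=
  exists (f : 'I_r -> 'I_m) (g : 'I_r -> 'I_n) (l : nat),
    [/\ {homo f : a b / (a < b)%N >-> (a < b)%N},
        {homo g : a b / (a < b)%N >-> (a < b)%N},
        (l < k)%N
      & p = (\det (\matrix_(a, b) Xt F m n k (f a) (g b)))`_l].

Definition in_Z (F : closedFieldType) (m n r k : nat) (x : 'I_(nvars m n k) -> F) : Prop :=
  forall p, @minor_coeff_gen F m n r k p -> p.@[x] = 0.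

Definition IZ (F : closedFieldType) (m n r k : nat) (p : {mpoly F[nvars m n k]}) : Prop :=
  forall x, @in_Z F m n r k x -> p.@[x] = 0.

(* Main.v *)
Require Import Defs.
From HB Require Import structures.
From mathcomp Require Import all_boot all_order all_algebra.
From mathcomp Require Import mpoly.
From mathcomp Require Import zify ring.
From Stdlib Require Import Classical ClassicalEpsilon FunctionalExtensionality.
Set Implicit Arguments. Unset Strict Implicit. Unset Printing Implicit Defensive.
Import Order.TTheory GRing.Theory.
Local Open Scope ring_scope.

(** Write r = q + 2 and work in the local ring at the origin. For i = 0, 1 let Z_i be the closure of the
    set of X(t) in Z whose Schur complement Y(t), taken with respect to an invertible leading q x q
    block, is t^i u(t) v(t) + t^(k-i) W(t); both pass through the origin because Z is a cone. If the
    constant term of Y is nonzero, the vanishing mod t^k of its 2 x 2 minors forces its 3 x 3 minors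
    to vanish mod t^(2k), whereas on Z_1 the coefficient of t^(2k-1) of such a minor is not
    identically zero. This yields two functions with product zero on Z, neither of them zero near the
    origin, so the local ring is not a domain.

    Z_i is parametrized by an affine space of dimension e_i, with
    e_1 - e_0 = (m - q - 2)(n - q - 2) - 2, which is zero only for (m, n) = (r + 1, r + 2). The depth
    of the local ring is at most min(e_0, e_1): a regular sequence is algebraically independent modulo
    the annihilator of any nonzero element, in particular of a function supported on Z_i, while more
    than e_i polynomials in e_i variables are algebraically dependent. The dimension is at least
    max(e_0, e_1): a parametrization of Z_i by triangular factors degenerates to the origin by killing
    its parameters one at a time, which gives a chain of primes of length e_i. *)

(** * Polynomial rings are Noetherian *)

Lemma not_all_imply (T : Type) (P Q : T -> Prop) :
  ~ (forall x, P x -> Q x) -> exists x, P x /\ ~ Q x.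
Proof. by move=> /not_all_ex_not[x H]; exists x; apply: imply_to_and. Qed.

Definition strictly_increasing (phi : nat -> nat) := forall i, (phi i < phi i.+1)%N.

Lemma strictly_increasing_lt (phi : nat -> nat) : strictly_increasing phi ->
  {homo phi : i j / (i < j)%N}.
Proof. by move=> H; apply: homo_ltn => //; apply: ltn_trans. Qed.

Lemma min_nat (P : nat -> Prop) (mu : nat -> nat) :
  (exists i, P i) -> exists i, P i /\ forall j, P j -> (mu i <= mu j)%N.
Proof.
move=> [i]; elim/ltn_ind: {i}(mu i) {-2}i (erefl (mu i)) => v IH i def_v Pi.
have [H|/not_all_imply[j [Pj /negP]]] :=
  classic (forall j, P j -> (mu i <= mu j)%N); first by exists i.
by rewrite -ltnNge def_v => lt_j; apply: (IH (mu j)) lt_j j erefl Pj.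
Qed.

(** [f i] is an index beyond [i] at which that tail of [u] attains its minimum; the iterates of [f]
    form the subsequence. *)
Lemma monotone_subsequence (u : nat -> nat) :
  exists2 phi, strictly_increasing phi & forall i j, (i <= j)%N -> (u (phi i) <= u (phi j))%N.
Proof.
have ex_min i : exists j, (i < j)%N /\ forall j', (i < j')%N -> (u j <= u j')%N.
  by apply: min_nat; exists i.+1.
pose f i := sval (constructive_indefinite_description _ (ex_min i)).
have fP i : (i < f i)%N /\ forall j', (i < j')%N -> (u (f i) <= u j')%N.
  by rewrite /f; case: constructive_indefinite_description.
exists (fun i => iter i.+1 f 0%N) => [i|]; first exact: (fP _).1.
apply: (homo_leq (r := leq)) => // [? ? ?|i]; first exact: leq_trans.
by rewrite iterS; apply: (fP _).2; apply: ltn_trans (fP _).1 (fP _).1.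
Qed.

(** Coordinates are made monotone one at a time; passing to a further subsequence preserves those
    already treated. *)
Lemma dickson (n : nat) (u : nat -> 'X_{1..n}) :
  exists2 phi, strictly_increasing phi &
    forall i j, (i <= j)%N -> (u (phi i) <= u (phi j))%MM.
Proof.
suff /(_ n)[phi phi_inc phi_le] : forall d, exists2 phi, strictly_increasing phi &
    forall (c : 'I_n), (c < d)%N -> forall i j, (i <= j)%N -> (u (phi i) c <= u (phi j) c)%N.
  by exists phi => // i j le_ij; apply/mnm_lepP => c; apply: phi_le.
elim=> [|d [phi phi_inc phi_le]]; first by exists id.
have [le_nd|lt_dn] := leqP n d.
  by exists phi => // c _; apply: phi_le; apply: leq_trans le_nd.
have [psi psi_inc psi_le] := monotone_subsequence (fun i => u (phi i) (Ordinal lt_dn)).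
exists (phi \o psi) => [i|c]; first exact: strictly_increasing_lt phi_inc _ _ (psi_inc i).
rewrite ltnS leq_eqVlt => /orP[/eqP def_c i j le_ij|lt_cd i j le_ij].
  have -> : c = Ordinal lt_dn by apply: val_inj.
  exact: (psi_le i j le_ij).
apply: (phi_le c lt_cd (psi i) (psi j)).
move: le_ij; rewrite leq_eqVlt => /orP[/eqP-> //|lt_ij].
exact: ltnW (strictly_increasing_lt psi_inc lt_ij).
Qed.

Lemma min_mlead (n : nat) (F : fieldType) (P : {mpoly F[n]} -> Prop) :
  (exists p, P p) -> exists p, P p /\ forall q, P q -> ~~ (mlead q < mlead p)%O.
Proof.
move=> [p]; elim/(well_founded_ind (@ltom_wf n)): {p}(mlead p) {-2}p (erefl (mlead p)).
move=> v IH p def_v Pp.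
have [H|/not_all_imply[q [Pq /negP]]] :=
  classic (forall q, P q -> ~~ (mlead q < mlead p)%O); first by exists p.
by rewrite negbK def_v => lt_q; apply: (IH (mlead q)) lt_q q erefl Pq.
Qed.

Lemma mlead_cancel (n : nat) (F : fieldType) (p q : {mpoly F[n]}) :
  p != 0 -> q != 0 -> (mlead q <= mlead p)%MM ->
  exists c, p - c * q = 0 \/ (mlead (p - c * q) < mlead p)%O.
Proof.
move=> p0 q0 le_qp; pose c := (mleadc p / mleadc q) *: 'X_[mlead p - mlead q] : {mpoly F[n]}.
have lq0 : mleadc q != 0 by rewrite mleadc_eq0.
have lp0 : mleadc p != 0 by rewrite mleadc_eq0.
have cc0 : mleadc p / mleadc q != 0 by rewrite mulf_neq0 ?invr_eq0.
have c0 : c != 0 by rewrite mscalerI negb_or cc0 -mleadc_eq0 mleadXm mcoeffX eqxx oner_eq0.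
have lcq : mlead (c * q) = mlead p.
  by rewrite mleadM // mleadZ // mleadXm submK.
exists c; have [->|r0] := eqVneq (p - c * q) 0; [by left | right].
have le_r : (mlead (p - c * q) <= mlead p)%O.
  by apply: le_trans (mleadB_le _ _) _; rewrite lcq joinxx.
rewrite lt_neqAle le_r andbT; apply/eqP => def_l.
have cq : (c * q)@_(mlead p) = mleadc p.
  rewrite -[in LHS]lcq mleadM // mleadcM mleadZ // mleadXm.
  by rewrite mcoeffZ mcoeffX eqxx mulr1 divfK.
by move: (r0); rewrite -mleadc_eq0 def_l mcoeffB cq subrr eqxx.
Qed.

(** Were every inclusion strict, let [f i] have minimal leading monomial among the elements outside
    [I i] that lie in some later ideal. Dickson's lemma gives two of these, the earlier leading
    monomial dividing the later one; a division step leaves a remainder still outside [I b] with a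
    smaller leading monomial. *)
Lemma noetherian (n : nat) (F : fieldType) (I : nat -> {mpoly F[n]} -> Prop) :
  (forall i, is_ideal (I i)) -> (forall i p, I i p -> I i.+1 p) ->
  exists i, forall p, I i.+1 p -> I i p.
Proof.
move=> Iid Iinc; apply: NNPP => /not_ex_all_not noI.
have Imono i j p : (i <= j)%N -> I i p -> I j p.
  by move=> /subnK <-; elim: (j - i)%N => //= d IH /IH; apply: Iinc.
pose P i p := ~ I i p /\ exists j, I j p.
have Pex i : exists p, P i p.
  by have /not_all_imply[p [Ip nIp]] := noI i; exists p; split; last exists i.+1.
have ex_f i : exists p, P i p /\ forall q, P i q -> ~~ (mlead q < mlead p)%O.
  exact: min_mlead.
pose f i := sval (constructive_indefinite_description _ (ex_f i)).
have fP i : P i (f i) /\ forall q, P i q -> ~~ (mlead q < mlead (f i))%O.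
  by rewrite /f; case: constructive_indefinite_description.
have ex_g i : exists j, I j (f i) by case: (fP i) => [[]].
pose g0 i := sval (constructive_indefinite_description _ (ex_g i)).
have g0P i : I (g0 i) (f i) by rewrite /g0; case: constructive_indefinite_description.
(* The indices skip ahead so that [f (g i)] already lies in [I (g i.+1)]. *)
pose g i := iter i (fun i => maxn (g0 i) i.+1) 0%N.
have g_inc i : (g i < g i.+1)%N by rewrite /g iterS leq_maxr.
have gP i : I (g i.+1) (f (g i)).
  by apply: Imono (g0P _); rewrite {2}/g iterS leq_maxl.
have [phi phi_inc phi_le] := dickson (fun i => mlead (f (g i))).
set a := g (phi 0%N); set b := g (phi 1%N).
have Ibfa : I b (f a).
  by apply: Imono (gP _); rewrite (homo_leq (r := leq)) //; [apply: leq_trans | move=> i; apply: ltnW].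
have nz i : f i != 0.
  by apply/eqP => f0; case: (fP i) => [[]]; rewrite f0; case: (Iid i).
have [c] := mlead_cancel (nz b) (nz a) (phi_le 0%N 1%N isT).
have [[nIb [j Ij]] minb] := fP b.
have nIbr : ~ I b (f b - c * f a).
  move=> Ib; apply: nIb; have [_ addI mulI] := Iid b.
  by rewrite -(subrK (c * f a) (f b)); apply: addI => //; apply: mulI.
case=> [r0|]; first by apply: nIbr; rewrite r0; case: (Iid b).
apply/negP; apply: minb; split=> //; exists (maxn j b).
have [_ addI mulI] := Iid (maxn j b).
apply: addI; first by apply: Imono Ij; apply: leq_maxl.
by rewrite -mulNr; apply: mulI; apply: Imono Ibfa; apply: leq_maxr.
Qed.

(** * Regular sequences and algebraic independence *)

(* Exponent vectors of length d with entries below N. *)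
Fixpoint words (N d : nat) : seq (seq nat) :=
  if d is d'.+1 then [seq a :: w | a <- iota 0 N, w <- words N d'] else [:: [::]].

Lemma size_words (N d : nat) : size (words N d) = (N ^ d)%N.
Proof. by elim: d => //= d IH; rewrite size_allpairs size_iota IH expnS. Qed.

Lemma words_uniq (N d : nat) : uniq (words N d).
Proof.
elim: d => //= d IH; apply: allpairs_uniq => //; first exact: iota_uniq.
by move=> [a w] [a' w'] _ _ /= [-> ->].
Qed.

Lemma mem_words_cons (N d a : nat) (w : seq nat) :
  (a :: w \in words N d.+1) = (a < N)%N && (w \in words N d).
Proof.
apply/allpairsP/andP => [[[b w'] /= [bN w'N [-> ->]]]|[aN wN]].
  by move: bN; rewrite mem_iota.
by exists (a, w); rewrite mem_iota.
Qed.

(** The value at [s] of a general polynomial of degree below [N] in each variable, with coefficients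
    [v]. Indexing by words lets a recursion on [s] split off the first variable. *)
Definition comb (F : fieldType) (n N : nat) (v : seq nat -> F) (s : seq {mpoly F[n]}) :=
  \sum_(w <- words N (size s)) v w *: \prod_(p <- zip w s) p.2 ^+ p.1.

Lemma comb_nil (F : fieldType) (n N : nat) (v : seq nat -> F) :
  comb N v [::] = (v [::])%:MP :> {mpoly F[n]}.
Proof. by rewrite /comb /= big_seq1 big_nil -mul_mpolyC mulr1. Qed.

Lemma comb_cons (F : fieldType) (n N : nat) (v : seq nat -> F) x (s : seq {mpoly F[n]}) :
  comb N v (x :: s) = \sum_(a < N) x ^+ a * comb N (fun w => v (nat_of_ord a :: w)) s.
Proof.
rewrite /comb /= big_allpairs_dep -(big_mkord xpredT (fun a => x ^+ a *
  \sum_(w <- words N (size s)) v (a :: w) *: \prod_(p <- zip w s) p.2 ^+ p.1)).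
rewrite /index_iota subn0; apply: eq_bigr => a _; rewrite big_distrr /=.
by apply: eq_bigr => w _; rewrite big_cons /= scalerAr.
Qed.

Lemma comb0 (F : fieldType) (n N : nat) (v : seq nat -> F) (s : seq {mpoly F[n]}) :
  {in words N (size s), forall w, v w = 0} -> comb N v s = 0.
Proof. by move=> v0; apply: big1_seq => w /andP[_ /v0->]; rewrite scale0r. Qed.

(** For a prime [M], the saturated ideals are the contractions of ideals of the localization at [M];
    they stand in for the local ring below. *)
Definition saturated (R : comNzRingType) (M Q : R -> Prop) :=
  forall u y, ~ M u -> Q (u * y) -> Q y.

Lemma ideal_sub (R : comNzRingType) (Q : R -> Prop) x y :
  is_ideal Q -> Q x -> Q y -> Q (x - y).
Proof. by move=> [_ addQ mulQ] Qx Qy; apply: addQ => //; rewrite -mulN1r; apply: mulQ. Qed.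

Definition saturation (R : comNzRingType) (M Q : R -> Prop) (x : R) :=
  exists u, ~ M u /\ Q (u * x).

Lemma saturation_ideal (R : comNzRingType) (J M Q : R -> Prop) :
  prime_over J M -> is_ideal Q -> is_ideal (saturation M Q).
Proof.
move=> [Mid _ M1 Mp] [Q0 addQ mulQ]; split.
- by exists 1; rewrite mulr0.
- move=> x y [u [Mu Qx]] [w [Mw Qy]]; exists (u * w); split; first by case/Mp.
  by rewrite mulrDr -mulrA mulrCA -mulrA; apply: addQ; apply: mulQ.
- by move=> a x [u [Mu Qx]]; exists u; rewrite mulrCA; split=> //; apply: mulQ.
Qed.

Lemma saturation_saturated (R : comNzRingType) (J M Q : R -> Prop) :
  prime_over J M -> saturated M (saturation M Q).
Proof.
move=> [_ _ _ Mp] u y Mu [w [Mw Qy]]; exists (w * u); split; first by case/Mp.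
by rewrite -mulrA.
Qed.

(* Krull's intersection theorem for the principal ideal (s): a nonzero submodule K = Ann(G) of
   (R/Q)_M with K inside s(R/Q)_M would satisfy K = sK, since s is a nonzerodivisor. *)
Lemma annihilator_not_divisible (F : fieldType) (n : nat) (J M Q Q' : {mpoly F[n]} -> Prop) s G :
  prime_over J M -> is_ideal Q -> saturated M Q -> M s -> (forall y, Q (s * y) -> Q y) ->
  (forall z, Q' z -> exists u w, ~ M u /\ Q (u * z - s * w)) ->
  (exists z, ~ Q z /\ Q (G * z)) -> exists z, ~ Q' z /\ Q (G * z).
Proof.
move=> Mprime Qid Qsat Ms sreg Q'P [z0 [Qz0 QGz0]]; have [[M0 addM mulM] _ M1 Mp] := Mprime.
have [Q0 addQ mulQ] := Qid.
apply: NNPP => noz; pose K := {z | ~ Q z /\ Q (G * z)}.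
have ex_next (z : K) : exists z' : K, exists u, ~ M u /\ Q (u * sval z - s * sval z').
  case: z => z [Qz QGz] /=; have Q'z : Q' z by apply: NNPP => H; apply: noz; exists z.
  have [u [w [Mu Quw]]] := Q'P z Q'z.
  have Qw : ~ Q w.
    move=> Qw; apply: Qz; apply: (Qsat u) => //; rewrite -[u * z](subrK (s * w)).
    by apply: addQ => //; apply: mulQ.
  have QGw : Q (G * w).
    apply: sreg; have -> : s * (G * w) = u * (G * z) - G * (u * z - s * w) by ring.
    by apply: ideal_sub => //; apply: mulQ.
  by exists (exist _ w (conj Qw QGw)); exists u.
pose next z := sval (constructive_indefinite_description _ (ex_next z)).
have nextP z : exists u, ~ M u /\ Q (u * sval z - s * sval (next z)).
  by rewrite /next; case: constructive_indefinite_description.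
pose z i : {mpoly F[n]} := sval (iter i next (exist _ z0 (conj Qz0 QGz0) : K)).
have zP i : ~ Q (z i) by rewrite /z; case: (iter _ _ _) => ? [].
have zS i : exists u, ~ M u /\ Q (u * z i - s * z i.+1) by apply: nextP.
(* [L i] is the contraction of the ideal that [Q] and [z i] generate locally; these ascend because
   [z i] is, up to a unit, [s] times [z i.+1]. *)
pose L i := saturation M (fun x => exists c, Q (x - c * z i)).
have Lid i : is_ideal (L i).
  apply: (saturation_ideal Mprime); split.
  - by exists 0; rewrite mul0r subrr.
  - move=> x y [c Qc] [c' Qc']; exists (c + c').
    by have -> : x + y - (c + c') * z i = (x - c * z i) + (y - c' * z i) by [ring]; apply: addQ.
  - move=> a x [c Qc]; exists (a * c).
    by have -> : a * x - a * c * z i = a * (x - c * z i) by [ring]; apply: mulQ.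
have Linc i x : L i x -> L i.+1 x.
  move=> [u [Mu [c Qc]]]; have [u' [Mu' Qu']] := zS i.
  exists (u' * u); split; first by case/Mp.
  exists (c * s); have -> : u' * u * x - c * s * z i.+1 =
    u' * (u * x - c * z i) + c * (u' * z i - s * z i.+1) by ring.
  by apply: addQ; apply: mulQ.
have [i Li] := noetherian Lid Linc.
have /Li [u [Mu [c Qc]]] : L i.+1 (z i.+1).
  by exists 1; split=> //; exists 1; rewrite subrr.
have [u' [Mu' Qu']] := zS i.
(* Once the chain stops, [z i.+1] is locally a multiple of [z i], hence of [s * z i.+1]. As [s] lies
   in [M], the factor [u' * u - c * s] is a local unit killing [z i.+1]. *)
apply: (zP i.+1); apply: (Qsat (u' * u - c * s)).
  move=> Mus; have /Mp[//|//] : M (u' * u).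
  by rewrite -[u' * u](subrK (c * s)); apply: addM => //; apply: mulM.
have -> : (u' * u - c * s) * z i.+1 =
  u' * (u * z i.+1 - c * z i) + c * (u' * z i - s * z i.+1) by ring.
by apply: addQ; apply: mulQ.
Qed.

(* A sequence regular on (R/Q)_M is algebraically independent over F modulo the annihilator of
   any nonzero element z of (R/Q)_M: hence the depth is at most the dimension at any associated prime. *)
Lemma regular_comb_neq0 (F : fieldType) (n : nat) (J M : {mpoly F[n]} -> Prop)
    (Q : nat -> {mpoly F[n]} -> Prop) (N : nat) (s : seq {mpoly F[n]}) :
  prime_over J M -> (forall i, is_ideal (Q i)) -> (forall i, saturated M (Q i)) ->
  (forall i, (i < size s)%N -> M s`_i) ->
  (forall i, (i < size s)%N -> forall y, Q i (s`_i * y) -> Q i y) ->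
  (forall i, (i < size s)%N -> forall z,
     Q i.+1 z <-> exists u w, ~ M u /\ Q i (u * z - s`_i * w)) ->
  forall v z, (exists2 w, w \in words N (size s) & v w != 0) -> ~ Q 0 z ->
  ~ Q 0 (comb N v s * z).
Proof.
move=> Mprime; elim: s Q => [|x s IH] Q Qid Qsat sM sreg QS v z [w wN vw] Qz.
  move: wN vw; rewrite inE => /eqP-> v0 Qvz; apply: Qz; have [_ _ mulQ] := Qid 0%N.
  have -> : z = (v [::])^-1%:MP * (comb N v [::] * z); last exact: mulQ.
  by rewrite comb_nil mulrA -mpolyCM mulVf // mpolyC1 mul1r.
case: w wN vw => [|a0 w0] in_words va0; first by case/allpairsP: in_words => [[? ?] []].
move: in_words; rewrite mem_words_cons => /andP[a0N w0N].
(* The least exponent [a] of [x] with a nonzero coefficient is taken; [x ^+ a] then factors out and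
   cancels by regularity. *)
pose nz a := has (fun w => v (a :: w) != 0) (words N (size s)).
have ex_nz : exists a, nz a && (a < N)%N by exists a0; rewrite a0N andbT; apply/hasP; exists w0.
have [a /andP[/hasP[w wN vaw] aN] a_min] := ex_minnP ex_nz.
set g := comb N (fun w => v (a :: w)) s.
have [h def_comb] : exists h, comb N v (x :: s) = x ^+ a * (g + x * h).
  exists (\sum_(b < N | (a < b)%N) x ^+ (b - a.+1) * comb N (fun w => v (nat_of_ord b :: w)) s).
  rewrite comb_cons (bigD1 (Ordinal aN)) //= mulrDr; congr (_ + _).
  rewrite (bigID (fun b : 'I_N => (a < b)%N)) /= [X in _ + X]big1 ?addr0; last first.
    move=> b /andP[ne_ba]; rewrite -leqNgt leq_eqVlt => /orP[/eqP eq_ba|lt_ba].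
      by case/eqP: ne_ba; apply: val_inj.
    rewrite comb0 ?mulr0 // => w' w'N; apply/eqP; apply: contraTT lt_ba => nz_b.
    by rewrite -leqNgt; apply: a_min; rewrite ltn_ord andbT; apply/hasP; exists w'.
  rewrite !big_distrr /=; apply: eq_big => [b|b /andP[_ lt_ab]].
    by rewrite andbC; case: ltnP => //= lt_ab; rewrite -val_eqE /= gtn_eqF.
  by rewrite !mulrA -exprSr -exprD subnKC.
have xreg y : Q 0%N (x * y) -> Q 0%N y by apply: (sreg 0%N).
have cancel_x e y : Q 0%N (x ^+ e * y) -> Q 0%N y.
  by elim: e => [|e IHe]; rewrite ?expr0 ?mul1r // exprS -mulrA => /xreg.
rewrite def_comb -mulrA => /cancel_x QGz.
(* Some [z'] outside [Q 1] is also killed by [g + x * h]; modulo [Q 1] the element [x] is zero, so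
   [g] alone kills [z'], against the induction hypothesis. *)
have [||z' [Q1z' QGz']] :=
  @annihilator_not_divisible F n J M (Q 0%N) (Q 1%N) x (g + x * h) Mprime (Qid _) (Qsat _) (sM 0%N isT) xreg.
- by move=> y /(QS 0%N isT).
- by exists z.
apply: (IH (fun i => Q i.+1) _ _ _ _ _ (fun w => v (a :: w)) z' _ Q1z') => //.
- by move=> i; apply: (sM i.+1).
- by move=> i; apply: (sreg i.+1).
- by move=> i; apply: (QS i.+1).
- by exists w.
apply/(QS 0%N isT); exists 1, (- (h * z')); split; first by case: Mprime.
by rewrite mul1r /=; have -> : g * z' - x * - (h * z') = (g + x * h) * z' by ring.
Qed.

Lemma in_ideal_gen_nat (R : comNzRingType) (J : R -> Prop) (s : seq R) (y : R) :
  in_ideal_gen J s y <-> exists c : nat -> R, J (y - \sum_(i < size s) c i * s`_i).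
Proof.
split=> [[c Jc]|[c Jc]]; last by exists c.
exists (fun i => if insub i is Some o then c o else 0).
by under eq_bigr => i _ do rewrite valK.
Qed.

Lemma in_ideal_gen_nil (R : comNzRingType) (J : R -> Prop) (y : R) :
  in_ideal_gen J [::] y <-> J y.
Proof.
split=> [[c]|Jy]; first by rewrite big_ord0 subr0.
by exists (fun=> 0); rewrite big_ord0 subr0.
Qed.

Lemma in_ideal_gen_rcons (R : comNzRingType) (J : R -> Prop) (s : seq R) (x y : R) :
  in_ideal_gen J (rcons s x) y <-> exists w, in_ideal_gen J s (y - x * w).
Proof.
have sumE (c : nat -> R) : \sum_(i < size (rcons s x)) c i * (rcons s x)`_i =
    \sum_(i < size s) c i * s`_i + c (size s) * x.
  rewrite size_rcons big_ord_recr /= nth_rcons ltnn eqxx; congr (_ + _).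
  by apply: eq_bigr => i _; rewrite nth_rcons ltn_ord.
split.
  move=> /in_ideal_gen_nat[c]; rewrite sumE => Jc; exists (c (size s)).
  by apply/in_ideal_gen_nat; exists c; move: Jc; congr J; ring.
move=> [w /in_ideal_gen_nat[c Jc]]; apply/in_ideal_gen_nat.
pose c' i := if i == size s then w else c i; exists c'; rewrite sumE {2}/c' eqxx.
have -> : \sum_(i < size s) c' i * s`_i = \sum_(i < size s) c i * s`_i.
  by apply: eq_bigr => i _; rewrite /c' ltn_eqF.
by move: Jc; congr J; ring.
Qed.

Lemma in_ideal_gen_ideal (R : comNzRingType) (J : R -> Prop) (s : seq R) :
  is_ideal J -> is_ideal (in_ideal_gen J s).
Proof.
move=> [J0 addJ mulJ]; split.
- by exists (fun=> 0); rewrite big1 ?subrr // => i _; rewrite mul0r.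
- move=> x y [c Jc] [c' Jc']; exists (fun i => c i + c' i).
  under eq_bigr => i _ do rewrite mulrDl.
  by rewrite big_split /= opprD addrACA; apply: addJ.
- move=> a x [c Jc]; exists (fun i => a * c i).
  under eq_bigr => i _ do rewrite -mulrA.
  by rewrite -big_distrr -mulrBr; apply: mulJ.
Qed.

Lemma loc_regular_comb_neq0 (F : fieldType) (n N : nat) (J M : {mpoly F[n]} -> Prop)
    (s : seq {mpoly F[n]}) (v : seq nat -> F) (z : {mpoly F[n]}) :
  is_ideal J -> prime_over J M -> loc_regular_seq J M s ->
  (exists2 w, w \in words N (size s) & v w != 0) -> ~ saturation M J z ->
  ~ saturation M J (comb N v s * z).
Proof.
move=> Jid Mprime [sM [_ sreg]] vn0 nz; have [_ _ M1 Mp] := Mprime.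
pose Q i := saturation M (in_ideal_gen J (take i s)).
have Q0E y : Q 0%N y <-> saturation M J y.
  by rewrite /Q take0; split=> -[u [Mu /in_ideal_gen_nil Ju]]; exists u; split=> //; apply/in_ideal_gen_nil.
have genid i : is_ideal (in_ideal_gen J (take i s)) by apply: in_ideal_gen_ideal.
move=> /Q0E; apply: (@regular_comb_neq0 F n J M Q N s Mprime) => //.
- by move=> i; apply: saturation_ideal Mprime _.
- by move=> i; apply: saturation_saturated Mprime.
- move=> i lt_is y; rewrite /Q (take_nth 0 lt_is); split.
    move=> [u [Mu /in_ideal_gen_rcons[w Jw]]]; exists u, w; split=> //.
    by exists 1; rewrite mul1r.
  move=> [u [w [Mu [u' [Mu' Ju]]]]]; exists (u' * u); split; first by case/Mp.
  by apply/in_ideal_gen_rcons; exists (u' * w); move: Ju; congr in_ideal_gen; ring.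
- by move/Q0E.
Qed.

Lemma msizeM_bound (F : fieldType) (e : nat) (p q : {mpoly F[e]}) (a b : nat) :
  (msize p <= a.+1)%N -> (msize q <= b.+1)%N -> (msize (p * q) <= (a + b).+1)%N.
Proof.
have [->|p0] := eqVneq p 0; first by rewrite mul0r msize0.
have [->|q0] := eqVneq q 0; first by rewrite mulr0 msize0.
by rewrite msizeM //; move: (msize p) (msize q) => x y; lia.
Qed.

Lemma msize_prod_exp (F : fieldType) (e D N : nat) (w : seq nat) (S : seq {mpoly F[e]}) :
  (forall p, p \in S -> (msize p <= D.+1)%N) -> w \in words N (size S) ->
  (msize (\prod_(p <- zip w S) p.2 ^+ p.1) <= (size S * N * D).+1)%N.
Proof.
elim: S w => [|p S IH] [|a w] SD; rewrite /= ?big_nil ?msize1 //.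
rewrite -/(words N (size S).+1) mem_words_cons => /andP[aN wN]; rewrite big_cons /=.
have -> : ((size S).+1 * N * D = N * D + size S * N * D)%N by rewrite mulSn mulnDl.
apply: msizeM_bound; last by apply: IH => // q qS; apply: SD; rewrite inE qS orbT.
have : (msize (p ^+ a) <= (a * D).+1)%N.
  elim: a {aN} => [|a IHa]; first by rewrite expr0 msize1.
  by rewrite exprS mulSn; apply: msizeM_bound => //; apply: SD; rewrite inE eqxx.
by move=> /leq_trans; apply; rewrite ltnS leq_mul2r ltnW ?orbT.
Qed.

Lemma card_bmultinom (e b : nat) : (#|{: 'X_{1..e < b}}| <= b ^ e)%N.
Proof.
have lt_b (m : 'X_{1..e < b}) (i : 'I_e) : (m i < b)%N.
  apply: leq_ltn_trans (bmdeg m); rewrite mdegE (bigD1 i) //=; exact: leq_addr.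
pose f (m : 'X_{1..e < b}) : {ffun 'I_e -> 'I_b} := [ffun i => Ordinal (lt_b m i)].
have inj_f : injective f.
  move=> m m' /ffunP eq_f; apply: val_inj; apply/mnmP => i.
  by have := eq_f i; rewrite !ffunE => /(congr1 val).
by have := leq_card f inj_f; rewrite card_ffun !card_ord.
Qed.

Lemma leq_exp2r_weak (e a b : nat) : (a <= b)%N -> (a ^ e <= b ^ e)%N.
Proof. by case: e => // e; rewrite leq_exp2r. Qed.

(* With N large there are more products of powers below N of the S_j than monomials of the degree
   they can reach. *)
Lemma algebraic_dependence (F : fieldType) (e : nat) (S : seq {mpoly F[e]}) :
  (e < size S)%N -> exists N v,
    (exists2 w, w \in words N (size S) & v w != 0) /\ comb N v S = 0.
Proof.
set d := size S => lt_ed; pose D := \max_(p <- S) msize p.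
have SD p : p \in S -> (msize p <= D.+1)%N.
  by move=> pS; apply: leqW; rewrite /D (big_rem p) //= leq_maxl.
(* These choices give [b ^ e <= (c * N) ^ e < N ^ e.+1 <= N ^ d], so there are fewer monomials of
   degree below [b] than words. *)
pose c := (d * D).+1; pose N := (c ^ e).+1; pose b := (d * N * D).+1.
have lt_card : (#|{: 'X_{1..e < b}}| < size (words N d))%N.
  rewrite size_words; apply: leq_ltn_trans (card_bmultinom _ _) _.
  have le_b : (b <= c * N)%N by rewrite /b /c; nia.
  apply: leq_ltn_trans (leq_exp2r_weak e le_b) _.
  apply: (@leq_trans (N ^ e.+1)); last exact: leq_pexp2l.
  by rewrite expnMn expnS ltn_pmul2r ?expn_gt0.
pose pw i := \prod_(p <- zip (nth [::] (words N d) i) S) p.2 ^+ p.1.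
pose A := \matrix_(i < size (words N d), j < #|{: 'X_{1..e < b}}|) (pw i)@_(enum_val j : 'X_{1..e < b}).
(* A nonzero row killed by the coefficient matrix supplies the coefficients [v]. *)
have : kermx A != 0.
  rewrite kermx_eq0 -row_leq_rank -ltnNge.
  exact: leq_ltn_trans (rank_leq_col A) lt_card.
case/rowV0Pn=> u /sub_kermxP uA0 u0.
have [i ui] : exists i, u 0 i != 0.
  apply/existsP; apply: contraNT u0; rewrite negb_exists => /forallP ui0.
  by apply/eqP/rowP => i; rewrite mxE; apply/eqP; move: (ui0 i); rewrite negbK.
pose v w := if insub (index w (words N d)) is Some j then u 0 j else 0.
have vE (j : 'I_(size (words N d))) : v (nth [::] (words N d) j) = u 0 j.
  by rewrite /v index_uniq ?words_uniq // valK.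
exists N, v; split; first by exists (nth [::] (words N d) i); rewrite ?mem_nth // vE.
rewrite /comb -/d (big_nth [::]) big_mkord; apply/mpolyP => m; rewrite mcoeff0 raddf_sum /=.
have [lt_mb|le_bm] := ltnP (mdeg m) b.
  have /rowP /(_ (enum_rank (BMultinom lt_mb))) := uA0; rewrite !mxE => uAm; rewrite -[RHS]uAm.
  by apply: eq_bigr => j _; rewrite mcoeffZ mxE enum_rankK vE.
apply: big1 => j _; rewrite mcoeffZ memN_msupp_eq0 ?mulr0 //.
apply: msize_mdeg_ge; apply: leq_trans le_bm.
by apply: msize_prod_exp => //; rewrite mem_nth.
Qed.

(** With more than [e] elements, the images of [s] under [phi] would be algebraically dependent; the
    same combination of [s] itself would annihilate [z] modulo [J], which regularity forbids. *)
Lemma regular_sequence_bound (F : fieldType) (n e : nat) (phi : n.-tuple {mpoly F[e]})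
    (J M : {mpoly F[n]} -> Prop) (z : {mpoly F[n]}) (s : seq {mpoly F[n]}) :
  is_ideal J -> prime_over J M -> ~ saturation M J z ->
  (forall p, p \mPo phi = 0 -> J (p * z)) -> loc_regular_seq J M s -> (size s <= e)%N.
Proof.
move=> Jid Mprime nz phi_z sreg; rewrite leqNgt; apply/negP => lt_es.
have [|N [v [vn0 comb0]]] := @algebraic_dependence F e [seq p \mPo phi | p <- s].
  by rewrite size_map.
rewrite size_map in vn0; apply: (loc_regular_comb_neq0 Jid Mprime sreg vn0 nz).
exists 1; split; first by case: Mprime.
rewrite mul1r; apply: phi_z; rewrite -[RHS]comb0 /comb size_map raddf_sum.
apply: eq_bigr => w _ /=; rewrite comp_mpolyZ rmorph_prod; congr (_ *: _).
elim: s w {lt_es sreg vn0 comb0} => [|p s IH] [|a w] //=; rewrite ?big_nil // !big_cons /= IH.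
by rewrite rmorphXn.
Qed.

(** * Minors over truncated polynomials *)

Lemma dvdXnP (F : fieldType) (k : nat) (p : {poly F}) :
  reflect (forall l, (l < k)%N -> p`_l = 0) ('X^k %| p).
Proof.
apply: (iffP idP) => [/dvdpP[q ->] l lt_lk|p0]; first by rewrite coefMXn lt_lk.
apply/dvdpP; exists (drop_poly k p); rewrite -{1}(poly_take_drop k p).
suff -> : take_poly k p = 0 by rewrite add0r.
by apply/polyP => l; rewrite coef_take_poly coef0; case: ltnP => // /p0.
Qed.

Lemma coprimep_Xn (F : fieldType) (k : nat) (p : {poly F}) :
  p`_0 != 0 -> coprimep 'X^k p.
Proof.
by move=> p0; apply: coprimep_expl; rewrite coprimep_sym coprimepX /root horner_coef0.
Qed.

Lemma inverse_mod_Xn (F : fieldType) (k : nat) (p : {poly F}) :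
  p`_0 != 0 -> exists g, 'X^k %| g * p - 1.
Proof.
move=> /(coprimep_Xn k) /Bezout_eq1_coprimepP[[u v] /= uv1]; exists v.
by rewrite -uv1 opprD addrCA subrr addr0 -mulNr dvdp_mulIr.
Qed.

(** Column operations with [\adj A] in place of the inverse of [A] avoid division at the price of
    extra powers of [\det A]. *)
Lemma schur_det (R : comNzRingType) (p s : nat) (A : 'M[R]_p) (B : 'M_(p, s))
    (C : 'M_(s, p)) (D : 'M_s) :
  \det (block_mx A B C D) * \det A ^+ s =
  \det A * \det (\det A *: D - C *m \adj A *m B).
Proof.
have def_prod : block_mx A B C D *m block_mx 1%:M (- (\adj A *m B)) 0 (\det A)%:M =
    block_mx A 0 C (\det A *: D - C *m \adj A *m B).
  rewrite mulmx_block !mulmx1 !mulmx0 !addr0 !mulmxN !mulmxA mul_mx_adj.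
  by rewrite mul_scalar_mx !mul_mx_scalar addNr [- _ + _]addrC.
by rewrite -(det_lblock A C) -def_prod det_mulmx det_ublock det1 mul1r det_scalar.
Qed.

(* The block matrix (1, -Q; P, t^(k-i) W) with P = (U, t^i x) and Q = (V; y) has determinant
   det(PQ + t^(k-i) W); scaling its first q columns by t^(k-i) and the next one by t^(k-2i) makes all
   its lower rows divisible by t^(k-i). *)
Lemma det_low_rank (R : idomainType) (q i k : nat) (t : R) (U : 'M_(q + 2, q)) (V : 'M_(q, q + 2))
    (x : 'cV_(q + 2)) (y : 'rV_(q + 2)) (W : 'M_(q + 2)) :
  t != 0 -> (2 * i <= k)%N ->
  exists c, \det (U *m V + t ^+ i *: (x *m y) + t ^+ (k - i) *: W) = t ^+ k * c.
Proof.
move=> t0 le_ik; set N := _ + _; set c := t ^+ (k - i).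
pose P := row_mx U (t ^+ i *: x); pose Q := col_mx V y.
pose E := block_mx c%:M 0 0 (t ^+ (k - 2 * i))%:M : 'M_(q + 1).
have PE : P *m E = c *: row_mx U x.
  rewrite mul_row_block !mulmx0 addr0 add0r !mul_mx_scalar scale_row_mx scalerA -exprD.
  by congr (row_mx _ (t ^+ _ *: _)); lia.
have detN : \det (block_mx 1%:M (- Q) P (c *: W)) = \det N.
  have : block_mx 1%:M 0 (- P) 1%:M *m block_mx 1%:M (- Q) P (c *: W) =
         block_mx 1%:M (- Q) 0 N.
    rewrite mulmx_block !mul1mx !mul0mx !addr0 mulmx1 addNr mulNmx mulmxN opprK.
    by rewrite mul_row_col -scalemxAl.
  move=> /(congr1 determinant); rewrite det_mulmx det_lblock det_ublock !det1 !mul1r; apply.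
exists (\det (block_mx E (- Q) (row_mx U x) W)).
have : block_mx 1%:M (- Q) P (c *: W) *m block_mx E 0 0 1%:M =
       block_mx 1%:M 0 0 c%:M *m block_mx E (- Q) (row_mx U x) W.
  rewrite !mulmx_block !mul1mx !mulmx0 !mul0mx !mulmx1 !addr0 !add0r PE.
  by rewrite -!mul_scalar_mx.
move=> /(congr1 determinant); rewrite !det_mulmx detN !det_ublock !det1 !det_scalar mulr1 mul1r.
rewrite expr1 => eq_det.
(* The exponents of [t] balance: [(q + 2) * (k - i) = k + q * (k - i) + (k - 2 * i)]. *)
have nz : c ^+ q * t ^+ (k - 2 * i) != 0 by rewrite mulf_neq0 ?expf_neq0.
apply: (mulIf nz); rewrite eq_det [t ^+ k * _]mulrC -[RHS]mulrA [RHS]mulrC; congr (_ * _).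
by rewrite mulrCA -exprD /c -!exprM -exprD; congr (_ ^+ _); lia.
Qed.

(** Associating [Y *m \adj Y *m \adj (\adj Y)] in two ways gives [\det Y *: \adj (\adj Y)] and
    [\det Y ^+ 2 *: Y]; one factor [\det Y] cancels. *)
Lemma adj_adj3 (R : idomainType) (Y : 'M[R]_3) :
  \det Y != 0 -> \adj (\adj Y) = \det Y *: Y.
Proof.
move=> d0; have det_adj : \det (\adj Y) = \det Y ^+ 2.
  by apply: (mulfI d0); rewrite -det_mulmx mul_mx_adj det_scalar exprS.
have : Y *m (\adj Y *m \adj (\adj Y)) = Y *m (\det (\adj Y))%:M by rewrite mul_mx_adj.
rewrite mulmxA mul_mx_adj mul_scalar_mx mul_mx_scalar det_adj expr2 -scalerA => /matrixP eqY.
by apply/matrixP => a b; move: (eqY a b); rewrite mxE [RHS]mxE => /(mulfI d0).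
Qed.

Lemma dvdp_det (F : fieldType) (s : nat) (d : {poly F}) (A : 'M[{poly F}]_s) :
  (forall a b, d %| A a b) -> d ^+ s %| \det A.
Proof.
move=> dA; have -> : A = d *: map_mx (fun p => p %/ d) A.
  by apply/matrixP => a b; rewrite !mxE mulrC divpK.
by rewrite detZ dvdp_mulIl.
Qed.

(* The entries of adj (adj Y) = det Y * Y are 2 x 2 minors of adj Y. *)
Lemma dvdp_det3 (F : fieldType) (k : nat) (Y : 'M[{poly F}]_3) :
  (forall a b, 'X^k %| \det (row' a (col' b Y))) -> (exists a b, (Y a b)`_0 != 0) ->
  'X^(2 * k) %| \det Y.
Proof.
move=> dY [a [b Yab]]; have [->|d0] := eqVneq (\det Y) 0; first exact: dvdp0.
have dadj c d : 'X^k %| \adj Y c d by rewrite mxE; apply: dvdp_mull.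
have : 'X^(2 * k) %| \adj (\adj Y) a b.
  rewrite mxE mulnC exprM; apply: dvdp_mull; apply: dvdp_det => c d.
  by rewrite mxE mxE; apply: dadj.
by rewrite adj_adj3 // mxE Gauss_dvdpl // coprimep_Xn.
Qed.

Definition catf (T : Type) (p s : nat) (f : 'I_p -> T) (g : 'I_s -> T) (i : 'I_(p + s)) : T :=
  match split i with inl a => f a | inr b => g b end.

Lemma mxsub_catf (R : Type) (m n p s : nat) (X : 'M[R]_(m, n)) f0 g0 (f : 'I_s -> 'I_m) g :
  mxsub (@catf _ p s f0 f) (@catf _ p s g0 g) X =
  block_mx (mxsub f0 g0 X) (mxsub f0 g X) (mxsub f g0 X) (mxsub f g X).
Proof.
apply/matrixP => a b; rewrite mxE /catf block_mxEh /row_mx mxE.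
by case: (split b) => b'; rewrite mxE; case: (split a) => a'; rewrite mxE.
Qed.

Lemma catf_homo (m p s : nat) (f : 'I_p -> 'I_m) (g : 'I_s -> 'I_m) :
  {homo f : a b / (a < b)%N} -> {homo g : a b / (a < b)%N} ->
  (forall a b, (f a < g b)%N) -> {homo catf f g : a b / (a < b)%N}.
Proof.
move=> fh gh fg a b; rewrite /catf; case: (splitP a) => a' ->; case: (splitP b) => b' -> //.
- exact: fh.
- by rewrite ltnNge (leq_trans (ltnW (ltn_ord b'))) // leq_addr.
- by rewrite ltn_add2l; apply: gh.
Qed.

(** The Schur complement of the pivot block, multiplied by the determinant of that block to avoid
    division. It keeps the full size of [X], so that its minors are indexed like those of [X]. *)
Definition schur (R : comNzRingType) (m n p : nat) (f0 : 'I_p -> 'I_m) (g0 : 'I_p -> 'I_n)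
    (X : 'M[R]_(m, n)) : 'M[R]_(m, n) :=
  \det (mxsub f0 g0 X) *: X - colsub g0 X *m \adj (mxsub f0 g0 X) *m rowsub f0 X.

Lemma mxsub_schur (R : comNzRingType) (m n p s : nat) f0 g0 (X : 'M[R]_(m, n))
    (f : 'I_s -> 'I_m) (g : 'I_s -> 'I_n) :
  mxsub f g (@schur R m n p f0 g0 X) =
  \det (mxsub f0 g0 X) *: mxsub f g X - mxsub f g0 X *m \adj (mxsub f0 g0 X) *m mxsub f0 g X.
Proof.
apply/matrixP => a b; rewrite mxE [RHS]mxE /schur mxE [(_ *: X) _ _]mxE.
rewrite [(_ *: mxsub _ _ _) _ _]mxE [mxsub f g X a b]mxE; congr (_ + _).
rewrite mxE [RHS]mxE !mxE; congr (- _); apply: eq_bigr => c _; rewrite !mxE; congr (_ * _).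
by apply: eq_bigr => d _; rewrite !mxE.
Qed.

(** This turns bordered minors of [X] into minors of the Schur complement, up to powers of the pivot
    minor; these are invertible modulo ['X^k] when its constant term is nonzero. *)
Lemma det_schur (R : comNzRingType) (m n p s : nat) f0 g0 (X : 'M[R]_(m, n))
    (f : 'I_s -> 'I_m) (g : 'I_s -> 'I_n) :
  \det (mxsub (catf f0 f) (catf g0 g) X) * \det (mxsub f0 g0 X) ^+ s =
  \det (mxsub f0 g0 X) * \det (mxsub f g (@schur R m n p f0 g0 X)).
Proof. by rewrite mxsub_catf schur_det mxsub_schur. Qed.

Lemma dvdp_det_congr (F : fieldType) (s : nat) (d : {poly F}) (A B : 'M[{poly F}]_s) :
  (forall a b, d %| A a b - B a b) -> d %| \det A - \det B.
Proof.
move=> dAB; have cong_prod (I : finType) (f g : I -> {poly F}) :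
    (forall i, d %| f i - g i) -> d %| \prod_i f i - \prod_i g i.
  move=> dfg; apply: (big_ind2 (fun p q => d %| p - q)) => [|p p' q q' dp dq|//].
    by rewrite subrr dvdp0.
  have -> : p * q - p' * q' = (p - p') * q + p' * (q - q') by ring.
  by apply: dvdp_add; [apply: dvdp_mulr | apply: dvdp_mull].
rewrite /determinant -sumrB; apply: (big_ind (fun p => d %| p)) => [|p q|sg _].
- exact: dvdp0.
- exact: dvdp_add.
by rewrite -mulrBr dvdp_mull // cong_prod.
Qed.

(** * Points of Z as matrices of polynomials *)

Section JetPoints.
Variables (F : closedFieldType) (m n k : nat).
Implicit Types (x : 'I_(nvars m n k) -> F) (X : 'M[{poly F}]_(m, n)).

(** The entries are lifted to [{poly F}] instead of being taken modulo ['X^k], so minors have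
    coefficients of degree [k] and above; one of them becomes a test function. *)
Definition ptmx x : 'M[{poly F}]_(m, n) :=
  \matrix_(a, b) \sum_(l < k) (x (enum_rank (a, b, l)))%:P * 'X^l.

Definition mxpt X (c : 'I_(nvars m n k)) : F :=
  let: (a, b, l) := enum_val c : 'I_m * 'I_n * 'I_k in (X a b)`_l.

Lemma mxptE X a b (l : 'I_k) : mxpt X (enum_rank (a, b, l)) = (X a b)`_l.
Proof. by rewrite /mxpt enum_rankK. Qed.

Lemma coef_ptmx x a b (l : 'I_k) : (ptmx x a b)`_l = x (enum_rank (a, b, l)).
Proof.
rewrite mxE coef_sum (bigD1 l) //= coefCM coefXn eqxx mulr1 big1 ?addr0 // => l' ne_l.
by rewrite coefCM coefXn val_eqE eq_sym (negPf ne_l) mulr0.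
Qed.

Lemma coef_ptmx_ge x a b l : (k <= l)%N -> (ptmx x a b)`_l = 0.
Proof.
move=> le_kl; rewrite mxE coef_sum big1 // => l' _.
by rewrite coefCM coefXn gtn_eqF ?mulr0 // (leq_trans _ le_kl).
Qed.

Lemma ptmxK X a b : 'X^k %| X a b - ptmx (mxpt X) a b.
Proof.
apply/dvdXnP => l lt_lk; rewrite coefB.
by have := coef_ptmx (mxpt X) a b (Ordinal lt_lk); rewrite mxptE /= => ->; rewrite subrr.
Qed.

Lemma minor_meval (s : nat) (f : 'I_s -> 'I_m) (g : 'I_s -> 'I_n) l x :
  ((\det (mxsub f g (Xt F m n k)))`_l).@[x] = (\det (mxsub f g (ptmx x)))`_l.
Proof.
rewrite -(coef_map (meval x)) -det_map_mx map_mxsub.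
suff -> : map_mx (map_poly (meval x)) (Xt F m n k) = ptmx x by [].
apply/matrixP => a b; rewrite !mxE rmorph_sum; apply: eq_bigr => l' _.
by rewrite rmorphM /= map_polyC map_polyXn /= mevalXU.
Qed.

Lemma in_ZP (r : nat) x : in_Z r x <->
  forall (f : 'I_r -> 'I_m) (g : 'I_r -> 'I_n),
    {homo f : a b / (a < b)%N} -> {homo g : a b / (a < b)%N} -> 'X^k %| \det (mxsub f g (ptmx x)).
Proof.
split=> [xZ f g fh gh|xZ p [f [g [l [fh gh lt_lk ->]]]]].
  apply/dvdXnP => l lt_lk; rewrite -minor_meval; apply: xZ; exists f, g, l; split=> //.
have -> : \matrix_(a, b) Xt F m n k (f a) (g b) = mxsub f g (Xt F m n k).
  by apply/matrixP => a b; rewrite !mxE.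
by rewrite minor_meval; apply/dvdXnP: lt_lk; apply: xZ.
Qed.

Lemma in_Z_mxpt (r : nat) X :
  (forall (f : 'I_r -> 'I_m) (g : 'I_r -> 'I_n), 'X^k %| \det (mxsub f g X)) -> in_Z r (mxpt X).
Proof.
move=> dX; apply/in_ZP => f g _ _.
rewrite -[\det _](subKr (\det (mxsub f g X))) dvdp_sub //.
by apply: dvdp_det_congr => a b; rewrite !mxE ; have := ptmxK X (f a) (g b); rewrite mxE.
Qed.

(** The triangular parametrization and the diagonal test points have this shape. *)
Lemma in_Z_low_rank (q i : nat) (U : 'M_(m, q)) (V : 'M_(q, n)) (u : 'cV_m) (v : 'rV_n) (W : 'M_(m, n)) :
  (2 * i <= k)%N ->
  in_Z (q + 2) (mxpt (U *m V + 'X^i *: (u *m v) + 'X^(k - i) *: W)).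
Proof.
move=> le_ik; apply: in_Z_mxpt => f g.
have [|c detE] := @det_low_rank _ q i k 'X (rowsub f U) (colsub g V) (rowsub f u) (colsub g v)
  (mxsub f g W) _ le_ik; first by rewrite polyX_eq0.
suff -> : mxsub f g (U *m V + 'X^i *: (u *m v) + 'X^(k - i) *: W) =
    rowsub f U *m colsub g V + 'X^i *: (rowsub f u *m colsub g v) + 'X^(k - i) *: mxsub f g W.
  by rewrite detE dvdp_mulIl.
apply/matrixP => a b; rewrite !mxE; congr (_ + _ * _ + _); apply: eq_bigr => c' _; by rewrite !mxE.
Qed.

Lemma in_Z_scale (r : nat) x (c : F) : in_Z r x -> in_Z r (fun i => c * x i).
Proof.
move=> /in_ZP xZ; apply/in_ZP => f g fh gh.
have -> : mxsub f g (ptmx (fun i => c * x i)) = c%:P *: mxsub f g (ptmx x).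
  apply/matrixP => a b; rewrite !mxE big_distrr; apply: eq_bigr => l _ /=.
  by rewrite polyCM mulrA.
by rewrite detZ dvdp_mull // xZ.
Qed.

End JetPoints.

(** * Block parametrization of the components *)

Section Congruence.
Variable (F : fieldType).
Implicit Types (p q r : {poly F}) (k : nat).

Definition eqX k p q := 'X^k %| p - q.

Lemma eqXx k p : eqX k p p. Proof. by rewrite /eqX subrr dvdp0. Qed.

Lemma eqX_sym k p q : eqX k p q -> eqX k q p.
Proof. by rewrite /eqX -opprB dvdpNr. Qed.

Lemma eqX_trans k p q r : eqX k p q -> eqX k q r -> eqX k p r.
Proof. by move=> pq qr; rewrite /eqX -(subrKA q) dvdp_add. Qed.

Lemma eqXD k p q p' q' : eqX k p q -> eqX k p' q' -> eqX k (p + p') (q + q').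
Proof. by move=> pq pq'; rewrite /eqX opprD addrACA dvdp_add. Qed.

Lemma eqXM k p q p' q' : eqX k p q -> eqX k p' q' -> eqX k (p * p') (q * q').
Proof.
move=> pq pq'; rewrite /eqX.
have -> : p * p' - q * q' = (p - q) * p' + q * (p' - q') by ring.
by apply: dvdp_add; [apply: dvdp_mulr | apply: dvdp_mull].
Qed.

Lemma eqX_sum k (I : finType) (p q : I -> {poly F}) :
  (forall i, eqX k (p i) (q i)) -> eqX k (\sum_i p i) (\sum_i q i).
Proof.
move=> pq; apply: (big_ind2 (eqX k)) => [|? ? ? ? ? ?|//]; first exact: eqXx.
exact: eqXD.
Qed.

Lemma eqX_shift i k p q : (i <= k)%N -> eqX (k - i) p q -> eqX k ('X^i * p) ('X^i * q).
Proof.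
move=> le_ik; rewrite /eqX -mulrBr -{2}(subnKC le_ik) exprD => pq.
by rewrite dvdp_mul2l ?expf_neq0 ?polyX_eq0.
Qed.

Lemma eqX_poly k (E : nat -> F) p :
  (forall l, (l < k)%N -> E l = p`_l) -> eqX k (\poly_(l < k) E l) p.
Proof.
by move=> Ep; apply/dvdXnP => l lt_lk; rewrite coefB coef_poly lt_lk Ep // subrr.
Qed.

End Congruence.

(* Schur form: the first q rows are free, the lower left block is U' times the upper left one, and
   the Schur complement is t^i u v + t^(k-i) W with u normalized to 1 in row q. *)
Definition block_param (R : comNzRingType) (m n k q i : nat) (lt_qm : (q < m)%N) (lt_qn : (q < n)%N)
    (y : 'I_m -> 'I_n -> nat -> R) : 'M[{poly R}]_(m, n) :=
  \matrix_(a, b)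
    if (a < q)%N then \poly_(l < k) y a b l else
    \sum_(p < q) (\poly_(l < k) y a (widen_ord (ltnW lt_qn) p) l) *
                 (\poly_(l < k) y (widen_ord (ltnW lt_qm) p) b l) +
    if (b < q)%N then 0 else
      'X^i * ((if a == q :> nat then 1 else \poly_(j < k - 2 * i) y a (Ordinal lt_qn) (i + j)%N) *
              (\poly_(j < k - 2 * i) y (Ordinal lt_qm) b (i + j)%N)) +
      'X^(k - i) * \poly_(j < i) y a b (k - i + j)%N.

(** After division by ['X^i], the 2 x 2 minors through the pivot entry make the Schur complement of
    rank one modulo ['X^(k - 2 * i)]. Multiplying back, the error becomes the term with factor
    ['X^(k - i)]. *)
Lemma block_cover (F : fieldType) (m n k q i : nat) (lt_qm : (q < m)%N) (lt_qn : (q < n)%N)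
    (X : 'M[{poly F}]_(m, n)) :
  let f0 := widen_ord (ltnW lt_qm) in let g0 := widen_ord (ltnW lt_qn) in
  let Y := schur f0 g0 X in
  let qm := Ordinal lt_qm in let qn := Ordinal lt_qn in
  (2 * i <= k)%N -> (\det (mxsub f0 g0 X))`_0 != 0 ->
  (forall (a : 'I_m) (b : 'I_n), (q <= a)%N -> (q <= b)%N -> 'X^i %| Y a b) -> (Y qm qn)`_i != 0 ->
  (forall (a : 'I_m) (b : 'I_n), (q < a)%N -> (q < b)%N -> eqX k (Y qm qn * Y a b) (Y qm b * Y a qn)) ->
  exists y, forall a b, eqX k (X a b) (block_param k i lt_qm lt_qn y a b).
Proof.
move=> f0 g0 Y qm qn le_ik; set A := mxsub f0 g0 X; set d := \det A => d0 Yi Yqq Y2.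
have [g gd] := inverse_mod_Xn k d0; rewrite -/(eqX k _ _) in gd.
have YdE a b : Y a b = d * X a b - (colsub g0 X *m \adj A *m rowsub f0 X) a b.
  by rewrite /Y /schur mxE [Z in Z + _]mxE [Z in _ + Z]mxE.
pose Y' a b := Y a b %/ 'X^i.
have YE (a : 'I_m) (b : 'I_n) : (q <= a)%N -> (q <= b)%N -> Y a b = 'X^i * Y' a b.
  by move=> qa qb; rewrite mulrC divpK ?Yi.
have Y'qq : (Y' qm qn)`_0 != 0 by move: Yqq; rewrite YE // coefXnM ltnn subnn.
have [h hY] := inverse_mod_Xn (k - 2 * i) Y'qq; rewrite -/(eqX _ _ _) in hY.
have Y'2 (a : 'I_m) (b : 'I_n) : (q < a)%N -> (q < b)%N ->
    eqX (k - 2 * i) (Y' qm qn * Y' a b) (Y' qm b * Y' a qn).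
  move=> qa qb; have := Y2 a b qa qb; rewrite !YE ?(ltnW qa) ?(ltnW qb) //.
  rewrite /eqX; have -> : 'X^i * Y' qm qn * ('X^i * Y' a b) - 'X^i * Y' qm b * ('X^i * Y' a qn) =
    'X^(2 * i) * (Y' qm qn * Y' a b - Y' qm b * Y' a qn) by rewrite mul2n -addnn exprD; ring.
  by rewrite -{1}(subnKC le_ik) exprD dvdp_mul2l ?expf_neq0 ?polyX_eq0.
(* [U] expresses the rows of [X] through its first [q] rows, [g] being the inverse of the pivot
   minor; [h] normalizes [u] to 1 in row [q]. *)
pose U a p := g * \sum_c (X a (g0 c) * \adj A c p).
pose u (a : 'I_m) := if a == q :> nat then 1 else \poly_(j < k - 2 * i) (h * Y' a qn)`_j.
pose v b := \poly_(j < k - 2 * i) (g * Y' qm b)`_j.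
have uv (a : 'I_m) (b : 'I_n) : (q <= a)%N -> (q <= b)%N -> eqX (k - 2 * i) (g * Y' a b) (u a * v b).
  move=> qa qb; have vb : eqX (k - 2 * i) (v b) (g * Y' qm b) by apply: eqX_poly.
  rewrite /u; case: eqP => [aq|/eqP ne_aq].
    have -> : a = qm by apply: val_inj.
    by rewrite mul1r; apply: eqX_sym.
  have ua : eqX (k - 2 * i) (\poly_(j < k - 2 * i) (h * Y' a qn)`_j) (h * Y' a qn).
    exact: eqX_poly.
  apply: eqX_sym; apply: eqX_trans (eqXM ua vb) _.
  have lt_qa : (q < a)%N by rewrite ltn_neqAle eq_sym ne_aq.
  have [bq|ne_bq] := eqVneq (b : nat) q.
    have -> : b = qn by apply: val_inj.
    have -> : h * Y' a qn * (g * Y' qm qn) = (h * Y' qm qn) * (g * Y' a qn) by ring.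
    by rewrite -[X in eqX _ _ X]mul1r; apply: eqXM hY (eqXx _ _).
  have lt_qb : (q < b)%N by rewrite ltn_neqAle eq_sym ne_bq.
  have -> : h * Y' a qn * (g * Y' qm b) = (h * g) * (Y' qm b * Y' a qn) by ring.
  apply: eqX_trans (eqXM (eqXx _ _) (eqX_sym (Y'2 a b lt_qa lt_qb))) _.
  have -> : h * g * (Y' qm qn * Y' a b) = (h * Y' qm qn) * (g * Y' a b) by ring.
  by rewrite -[X in eqX _ _ X]mul1r; apply: eqXM hY (eqXx _ _).
pose W a b := (g * Y' a b - u a * v b) %/ 'X^(k - 2 * i).
have WE (a : 'I_m) (b : 'I_n) : (q <= a)%N -> (q <= b)%N -> g * Y' a b = u a * v b + 'X^(k - 2 * i) * W a b.
  move=> qa qb; have := divpK (uv a b qa qb); rewrite -/(W a b) mulrC => ->.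
  by rewrite addrC subrK.
(* The option [insub] succeeds exactly when [b < q]. Past the pivot block, indices from [k - i] on
   hold [W]; lower ones hold [v] in row [q] and [u] in the other rows, shifted by [i]. *)
pose y (a : 'I_m) (b : 'I_n) l :=
  if (a < q)%N then (X a b)`_l else
  if insub (b : nat) is Some p then (U a p)`_l else
  if (k - i <= l)%N then (W a b)`_(l - (k - i))%N else
  if a == q :> nat then (g * Y' qm b)`_(l - i)%N else (h * Y' a qn)`_(l - i)%N.
have y_top (p : 'I_q) b : eqX k (\poly_(l < k) y (f0 p) b l) (X (f0 p) b).
  by apply: eqX_poly => l _; rewrite /y /= ltn_ord.
have y_left (a : 'I_m) (p : 'I_q) : (q <= a)%N -> eqX k (\poly_(l < k) y a (g0 p) l) (U a p).
  by move=> qa; apply: eqX_poly => l _; rewrite /y ltnNge qa /= valK.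
have UX a b : \sum_p U a p * X (f0 p) b = g * (colsub g0 X *m \adj A *m rowsub f0 X) a b.
  rewrite mxE big_distrr; apply: eq_bigr => p _; rewrite !mxE /U -mulrA; congr (_ * (_ * _)).
  by apply: eq_bigr => c _; rewrite [colsub _ _ _ _]mxE.
exists y => a b; rewrite mxE; case: ltnP => [lt_aq|qa].
  by apply: eqX_sym; apply: eqX_poly => l _; rewrite /y lt_aq.
apply: (@eqX_trans _ _ _ (g * d * X a b)).
  by rewrite -[Z in eqX _ Z _]mul1r; apply: eqXM (eqX_sym gd) (eqXx _ _).
have sumE : eqX k (\sum_(p < q) U a p * X (f0 p) b)
  (\sum_(p < q) \poly_(l < k) y a (widen_ord (ltnW lt_qn) p) l *
                \poly_(l < k) y (widen_ord (ltnW lt_qm) p) b l).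
  by apply: eqX_sum => p; apply: eqX_sym; apply: eqXM; [apply: y_left | apply: y_top].
have gdX : g * d * X a b = \sum_p U a p * X (f0 p) b + g * Y a b.
  by rewrite UX YdE; ring.
rewrite gdX; apply: eqXD sumE _; case: ltnP => [lt_bq|qb].
  (* Columns of the pivot block vanish in the Schur complement, because [\adj A *m A] is scalar. *)
  have -> : Y a b = 0; last by rewrite mulr0; apply: eqXx.
  pose p := Ordinal lt_bq; have -> : b = g0 p by apply: val_inj.
  rewrite YdE -mulmxA [Z in _ - Z]mxE.
  suff -> : \sum_j colsub g0 X a j * (\adj A *m rowsub f0 X) j (g0 p) =
            \sum_j X a (g0 j) * (d%:M : 'M_q) j p.
    rewrite (bigD1 p) //= big1 => [|j ne_jp]; last by rewrite mxE (negPf ne_jp) mulr0.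
    by rewrite mxE eqxx addr0 mulr1n mulrC subrr.
  apply: eq_bigr => j _; rewrite mxE -mul_adj_mx [in RHS]mxE mxE; congr (_ * _).
  by apply: eq_bigr => c _; rewrite !mxE.
have le1 : (i <= k)%N by lia.
rewrite YE // mulrCA WE // mulrDr ['X^i * ('X^_ * _)]mulrA -exprD; have -> : (i + (k - 2 * i) = k - i)%N by lia.
have vE : \poly_(j < k - 2 * i) y qm b (i + j)%N = v b.
  apply/polyP => j; rewrite !coef_poly; case: ltnP => // lt_j; rewrite /y ltnn insubN -?leqNgt //.
  by rewrite leqNgt (_ : (i + j < k - i)%N) /= ?eqxx ?addKn //; lia.
have uE : (if a == q :> nat then 1 else \poly_(j < k - 2 * i) y a qn (i + j)%N) = u a.
  rewrite /u; case: eqP => // /eqP ne_aq; apply/polyP => j; rewrite !coef_poly.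
  case: ltnP => // lt_j; rewrite /y ltnNge qa /= insubN -?leqNgt //= (negPf ne_aq).
  by rewrite leqNgt (_ : (i + j < k - i)%N) /= ?addKn //; lia.
rewrite vE uE; apply: eqXD; first exact: eqXx.
apply: eqX_shift; first by lia.
have -> : (k - (k - i) = i)%N by lia.
apply: eqX_sym; apply: eqX_poly => l lt_li; rewrite /y ltnNge qa /= insubN -?leqNgt //=.
by rewrite leq_addr addKn.
Qed.

(** * Counting the free parameters *)

Lemma sum_ord_geq (m q : nat) : (\sum_(a < m) (q <= a) = m - q)%N.
Proof.
elim: m => [|m IH]; first by rewrite big_ord0.
by rewrite big_ord_recr /= IH; case: leqP => ?; lia.
Qed.

Section ParameterSet.
Variables (m n k q i : nat).

(* Indices (a, b, l) of the coordinates that serve as names for the free parameters of the i-th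
   component; the coefficient of t^j in an entry multiplied by t^e has third index e + j. *)
Definition is_param (a b l : nat) : bool :=
  [|| (minn a b < q)%N, (minn a b == q) && (i <= l)%N | (q < minn a b)%N && (k - i <= l)%N].

Definition params : {set 'I_m * 'I_n * 'I_k} := [set c : 'I_m * 'I_n * 'I_k | is_param c.1.1 c.1.2 c.2].

Lemma card_params : (i <= k)%N ->
  #|params| = (\sum_(a < m) \sum_(b < n)
    if minn a b < q then k else if minn a b == q then k - i else i)%N.
Proof.
move=> le_ik; rewrite pair_bigA /=.
transitivity (\sum_(c : 'I_m * 'I_n * 'I_k) is_param c.1.1 c.1.2 c.2)%N.
  by rewrite -sum1dep_card big_mkcond; apply: eq_bigr => c _; case: is_param.
rewrite -(pair_bigA _ (fun (c : 'I_m * 'I_n) (l : 'I_k) => nat_of_bool (is_param c.1 c.2 l)))%N /=.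
apply: eq_bigr => -[a b] _ /=; rewrite /is_param; case: ltngtP => _ /=.
- by rewrite sum1_card card_ord.
- by rewrite sum_ord_geq subKn.
- by under eq_bigr => l _ do rewrite orbF; rewrite sum_ord_geq.
Qed.
End ParameterSet.

(** From [i = 0] to [i = 1], each position with [minn a b = q] loses one parameter and each with
    [minn a b > q] gains one. The identity is additive to avoid truncated subtraction. *)
Lemma card_params_diff (m n k q : nat) : (2 <= k)%N -> (q < m)%N -> (q < n)%N ->
  (#|params m n k q 1| + (m - q) * (n - q) =
   #|params m n k q 0| + 2 * ((m - q.+1) * (n - q.+1)))%N.
Proof.
move=> k2 lt_qm lt_qn; rewrite !card_params //; last exact: ltnW.
have sum_box p : (\sum_(a < m) \sum_(b < n) (p <= minn a b) = (m - p) * (n - p))%N.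
  rewrite -!sum_ord_geq big_distrl; apply: eq_bigr => a _ /=; rewrite big_distrr.
  by apply: eq_bigr => b _ /=; rewrite leq_min mulnb.
rewrite -!sum_box mul2n -addnn -!big_split /=; apply: eq_bigr => a _.
by rewrite -!big_split; apply: eq_bigr => b _ /=; case: ltngtP => _ //=; lia.
Qed.

(** * The block parametrization in independent variables *)

Section BlockParam.
Variables (m n k q i : nat) (lt_qm : (q < m)%N) (lt_qn : (q < n)%N) (le_ik : (2 * i <= k)%N).

Lemma block_param_map (R R' : comNzRingType) (f : {rmorphism R -> R'}) y :
  map_mx (map_poly f) (@block_param R m n k q i lt_qm lt_qn y) =
  block_param k i lt_qm lt_qn (fun a b l => f (y a b l)).
Proof.
have map_polyE N (E : nat -> R) : map_poly f (\poly_(l < N) E l) = \poly_(l < N) f (E l).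
  by apply/polyP => l; rewrite coef_map !coef_poly; case: ltnP => _ //; apply: raddf0.
apply/matrixP => a b; rewrite !mxE; case: ltnP => _; first exact: map_polyE.
rewrite rmorphD rmorph_sum; congr (_ + _).
  by apply: eq_bigr => p _; rewrite rmorphM /= !map_polyE.
case: ltnP => _; first by rewrite rmorph0.
rewrite rmorphD !rmorphM /= !map_polyXn !map_polyE; congr (_ * (_ * _) + _).
by case: eqP => _; rewrite ?rmorph1 ?map_polyE.
Qed.

(** Only values indexed by [is_param] are read, so [#|params m n k q i|] variables suffice. *)
Lemma block_param_eq (R : comNzRingType) (y y' : 'I_m -> 'I_n -> nat -> R) :
  (forall (a : 'I_m) (b : 'I_n) l, (l < k)%N -> is_param k q i a b l -> y a b l = y' a b l) ->
  @block_param R m n k q i lt_qm lt_qn y = block_param k i lt_qm lt_qn y'.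
Proof.
move=> yy'; have polyE N (E E' : nat -> R) : (forall l, (l < N)%N -> E l = E' l) ->
    \poly_(l < N) E l = \poly_(l < N) E' l.
  by move=> EE'; apply/polyP => l; rewrite !coef_poly; case: ltnP => // /EE'.
apply/matrixP => a b; rewrite !mxE; case: (ltnP a q) => [lt_aq|le_qa].
  by apply: polyE => l lt_lk; apply: yy' => //; rewrite /is_param gtn_min lt_aq.
congr (_ + _).
  apply: eq_bigr => p _; congr (_ * _); apply: polyE => l lt_lk; apply: yy' => //.
    by rewrite /is_param gtn_min /= ltn_ord orbT.
  by rewrite /is_param gtn_min /= ltn_ord.
case: (ltnP b q) => [//|le_qb]; congr (_ * (_ * _) + _ * _).
- case: eqP => [//|_]; apply: polyE => l lt_l; apply: yy'; first by lia.
  by rewrite /is_param (minn_idPr _) //= eqxx leq_addr orbT.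
- apply: polyE => l lt_l; apply: yy'; first by lia.
  by rewrite /is_param (minn_idPl _) //= eqxx leq_addr orbT.
apply: polyE => l lt_l; apply: yy'; first by lia.
rewrite /is_param; case: ltngtP => //= _; [by rewrite leq_addr | by rewrite orbF; lia].
Qed.

Variable F : closedFieldType.

(* The variable attached to (a, b, l), or 0 if (a, b, l) is not the index of a parameter. *)
Definition generic_param (a : 'I_m) (b : 'I_n) (l : nat) : {mpoly F[#|params m n k q i|]} :=
  \sum_(j < #|params m n k q i|)
    if [&& (enum_val j).1.1 == a, (enum_val j).1.2 == b & (enum_val j).2 == l :> nat] then 'X_j else 0.

Definition block_tuple : (nvars m n k).-tuple {mpoly F[#|params m n k q i|]} :=
  [tuple let: (a, b, l) := enum_val c : 'I_m * 'I_n * 'I_k in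
         (block_param k i lt_qm lt_qn generic_param a b)`_l | c < nvars m n k].

(** The identity [p \mPo block_tuple = 0] is specialized at the parameter values given by [y]. *)
Lemma block_tuple_vanish (x : 'I_(nvars m n k) -> F) y (p : {mpoly F[nvars m n k]}) :
  (forall a b, eqX k (ptmx x a b) (block_param k i lt_qm lt_qn y a b)) ->
  p \mPo block_tuple = 0 -> p.@[x] = 0.
Proof.
move=> xy p0; pose pt (j : 'I_#|params m n k q i|) : F :=
  y (enum_val j).1.1 (enum_val j).1.2 (enum_val j).2.
have genE (a : 'I_m) (b : 'I_n) l : (l < k)%N -> is_param k q i a b l -> (generic_param a b l).@[pt] = y a b l.
  move=> lt_lk par; pose c : 'I_m * 'I_n * 'I_k := (a, b, Ordinal lt_lk).
  have cT : c \in params m n k q i by rewrite inE.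
  rewrite /generic_param raddf_sum (bigD1 (enum_rank_in cT c)) //= enum_rankK_in // !eqxx /=.
  rewrite mevalXU /pt enum_rankK_in // big1 ?addr0 // => j ne_j.
  case: and3P => [[/eqP ea /eqP eb /eqP el]|_]; last exact: meval0.
  case/eqP: ne_j; apply: enum_val_inj; rewrite enum_rankK_in //.
  by rewrite /c -ea -eb; case: (enum_val j) el => [[a' b'] l'] /= el; congr (_, _, _); apply: val_inj.
have blockE : map_mx (map_poly (meval pt)) (block_param k i lt_qm lt_qn generic_param) =
    block_param k i lt_qm lt_qn y.
  rewrite block_param_map; apply: block_param_eq => a b l lt_lk par; exact: genE.
have blockl a b l : ((block_param k i lt_qm lt_qn generic_param a b)`_l).@[pt] =
    (block_param k i lt_qm lt_qn y a b)`_l.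
  by rewrite -blockE [map_mx _ _ a b]mxE coef_map.
have := congr1 (meval pt) p0; rewrite comp_mpoly_meval meval0 => p0'.
rewrite -[RHS]p0'; apply: meval_eq => c; rewrite tnth_mktuple -[c in x c]enum_valK.
case: (enum_val c) => [[a b] l]; rewrite -coef_ptmx blockl.
by have /dvdXnP/(_ l (ltn_ord l))/eqP := xy a b; rewrite coefB subr_eq0 => /eqP.
Qed.

End BlockParam.

(** * Triangular parametrization and chains of primes *)

Section TriangularParam.
Variables (m n k q i : nat) (lt_qm : (q < m)%N) (lt_qn : (q < n)%N) (le_ik : (2 * i <= k)%N).

Section Ring.
Variable R : comNzRingType.
Implicit Types y : 'I_m -> 'I_n -> nat -> R.

Definition lower_factor y : 'M[{poly R}]_(m, q) := \matrix_(a, p)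
  if (a < p)%N then 0 else if a == p :> nat then 1 else
  \poly_(l < k) y a (widen_ord (ltnW lt_qn) p) l.

Definition upper_factor y : 'M[{poly R}]_(q, n) := \matrix_(p, b)
  if (b < p)%N then 0 else \poly_(l < k) y (widen_ord (ltnW lt_qm) p) b l.

Definition last_col y : 'cV[{poly R}]_m := \col_a
  if (a < q)%N then 0 else if a == q :> nat then 1 else
  \poly_(j < k - 2 * i) y a (Ordinal lt_qn) (i + j)%N.

Definition last_row y : 'rV[{poly R}]_n := \row_b
  if (b < q)%N then 0 else \poly_(j < k - 2 * i) y (Ordinal lt_qm) b (i + j)%N.

Definition remainder y : 'M[{poly R}]_(m, n) := \matrix_(a, b)
  if (q <= a)%N && (q <= b)%N then \poly_(j < i) y a b (k - i + j)%N else 0.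

(** A variant of [block_param] with the same parameter set, in which a unit lower triangular factor
    times an upper triangular one replaces the rank [q] part. Triangularity makes single coordinates
    computable once suitable parameters vanish. *)
Definition triangular_param y : 'M[{poly R}]_(m, n) :=
  lower_factor y *m upper_factor y + 'X^i *: (last_col y *m last_row y) +
  'X^(k - i) *: remainder y.

Lemma triangular_paramE y a b : triangular_param y a b =
  \sum_p lower_factor y a p * upper_factor y p b + 'X^i * (last_col y a 0 * last_row y 0 b) +
  'X^(k - i) * remainder y a b.
Proof.
by rewrite /triangular_param mxE [X in X + _]mxE [X in _ + X]mxE mxE
           [X in _ + X + _]mxE [(last_col y *m _) _ _]mxE big_ord1.
Qed.

(** These are the parameters of [lower_factor] and [last_col], column index first; in column [q],
    coefficients from [k - i] on belong to [remainder]. *)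
Definition is_lower_param (b a l : nat) : bool :=
  [&& (b < a)%N, (b <= q)%N & (b == q) ==> (l < k - i)%N].

(** Killing the lower parameters leaves only the unit entries of [lower_factor] and [last_col], so
    the parametrization becomes linear. *)
Lemma triangular_param_linear y (a : 'I_m) (b : 'I_n) l : (l < k)%N ->
  (forall (a' : 'I_m) (b' : 'I_n) l', (l' < k)%N -> is_param k q i a' b' l' ->
     is_lower_param b' a' l' -> y a' b' l' = 0) ->
  is_param k q i a b l -> ~~ is_lower_param b a l -> (triangular_param y a b)`_l = y a b l.
Proof.
move=> lt_lk y0 par nlow.
have U1 p : lower_factor y a p = (a == p :> nat)%:R.
  rewrite mxE; case: ltngtP => // lt_pa; apply/polyP => j; rewrite coef_poly coef0.
  case: ltnP => // lt_jk; apply: y0 => //=.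
    by rewrite /is_param gtn_min /= ltn_ord orbT.
  by rewrite /is_lower_param /= lt_pa ltnW // ltn_eqF.
have u1 : last_col y a 0 = (a == q :> nat)%:R.
  rewrite mxE; case: ltngtP => // lt_qa; apply/polyP => j; rewrite coef_poly coef0.
  case: ltnP => // lt_j; apply: y0 => /=; first by lia.
    by rewrite /is_param (minn_idPr _) ?(ltnW lt_qa) //= eqxx leq_addr orbT.
  by rewrite /is_lower_param /= lt_qa leqnn eqxx /=; lia.
rewrite triangular_paramE u1 !coefD coef_sum.
have [lt_aq|lt_qa|eq_aq] := ltngtP a q.
- rewrite mul0r mulr0 coef0 addr0 [remainder y a b]mxE leqNgt lt_aq /= mulr0 coef0 addr0.
  have le_ab : (a <= b)%N.
    rewrite leqNgt; apply: contra nlow => lt_ba; rewrite /is_lower_param lt_ba.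
    by rewrite (ltnW (ltn_trans lt_ba lt_aq)) ltn_eqF // (ltn_trans lt_ba).
  rewrite (bigD1 (Ordinal lt_aq)) //= U1 eqxx mul1r mxE ltnNge le_ab /= coef_poly lt_lk.
  rewrite big1 ?addr0 => [|p ne_p]; first by congr y; apply: val_inj.
  rewrite U1; case: eqP => [ap|_]; last by rewrite mul0r coef0.
  by case/eqP: ne_p; apply: val_inj.
- rewrite big1 ?add0r => [|p _]; last first.
    by rewrite U1 gtn_eqF ?mul0r ?coef0 // (ltn_trans (ltn_ord p)).
  rewrite mul0r mulr0 coef0 add0r coefXnM.
  have le_qb : (q <= b)%N.
    rewrite leqNgt; apply: contra nlow => lt_bq; rewrite /is_lower_param (ltn_trans lt_bq lt_qa).
    by rewrite (ltnW lt_bq) ltn_eqF.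
  have le_l : (k - i <= l)%N.
    case/or3P: par => [lt_min|/andP[/eqP eq_min _]|/andP[_ //]]; first by lia.
    have eq_bq : b = q :> nat by lia.
    by move: nlow; rewrite /is_lower_param eq_bq eqxx lt_qa leqnn /= -leqNgt.
  rewrite ltnNge le_l /= mxE le_qb (ltnW lt_qa) /= coef_poly subnKC //.
  by have -> : (l - (k - i) < i)%N by lia.
- rewrite big1 ?add0r => [|p _]; last first.
    by rewrite U1 gtn_eqF ?mul0r ?coef0 // eq_aq ltn_ord.
  have le_qb : (q <= b)%N.
    rewrite leqNgt; apply: contra nlow => lt_bq; rewrite /is_lower_param eq_aq lt_bq.
    by rewrite (ltnW lt_bq) ltn_eqF.
  have le_il : (i <= l)%N.
    move: par; rewrite /is_param eq_aq (minn_idPl le_qb) ltnn eqxx orFb /= orbF.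
    by [].
  have -> : a = Ordinal lt_qm by apply: val_inj.
  rewrite mul1r !coefXnM ltnNge le_il /= !mxE ltnNge le_qb /= leqnn !coef_poly.
  case: (ltnP l (k - i)) => lt_l.
    have -> : (l - i < k - 2 * i)%N by lia.
    by rewrite subnKC // addr0.
  have -> : (l - i < k - 2 * i)%N = false by lia.
  have -> : (l - (k - i) < i)%N by lia.
  by rewrite add0r subnKC.
Qed.

Lemma coefM_low (p r : {poly R}) l : (forall j, (j < l)%N -> p`_j = 0) -> (p * r)`_l = p`_l * r`_0.
Proof.
move=> p0; rewrite coefM big_ord_recr /= subnn big1 ?add0r // => j _.
by rewrite p0 ?mul0r.
Qed.

(** Terms before column [b] vanish by assumption and those after it by triangularity. What remains
    is one product, whose coefficient at [l] uses only the lowest coefficient of the diagonal entry;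
    that coefficient has index [i] in [last_row] and 0 in [upper_factor]. *)
Lemma triangular_param_lower y (a : 'I_m) (b : 'I_n) l (lt_bm : (b < m)%N) : (l < k)%N ->
  is_param k q i a b l -> is_lower_param b a l ->
  (forall (a' : 'I_m) (b' : 'I_n) l', (l' < k)%N -> is_param k q i a' b' l' ->
     is_lower_param b' a' l' -> (b' < b)%N || (b' == b) && (l' < l)%N -> y a' b' l' = 0) ->
  (triangular_param y a b)`_l = y a b l * y (Ordinal lt_bm) b (if b == q :> nat then i else 0%N).
Proof.
move=> lt_lk par /and3P[lt_ba le_bq bq_l] y0.
have U0 (p : 'I_q) : (p < b)%N -> lower_factor y a p = 0.
  move=> lt_pb; have lt_pa := ltn_trans lt_pb lt_ba.
  rewrite mxE ltnNge (ltnW lt_pa) /= gtn_eqF //; apply/polyP => j; rewrite coef_poly coef0.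
  case: ltnP => // lt_jk; apply: y0 => //=; last by rewrite lt_pb.
    by rewrite /is_param gtn_min /= ltn_ord orbT.
  by rewrite /is_lower_param /= lt_pa ltnW // ltn_eqF.
rewrite triangular_paramE !coefD coef_sum.
have [lt_bq|lt_qb|eq_bq] := ltngtP (b : nat) q.
- rewrite (bigD1 (Ordinal lt_bq)) //= big1 ?addr0 => [|p ne_p]; last first.
    have [lt_pb|lt_bp|eq_pb] := ltngtP p b.
    - by rewrite U0 // mul0r coef0.
    - by rewrite [upper_factor y p b]mxE lt_bp mulr0 coef0.
    - by case/eqP: ne_p; apply: val_inj.
  rewrite [remainder y a b]mxE [(q <= b)%N]leqNgt lt_bq andbF mulr0 coef0 addr0.
  rewrite [last_row y _ _]mxE lt_bq !mulr0 coef0 addr0.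
  have b_widen : widen_ord (ltnW lt_qn) (Ordinal lt_bq) = b by apply: val_inj.
  have UE : lower_factor y a (Ordinal lt_bq) = \poly_(j < k) y a b j.
    by rewrite mxE /= ltnNge (ltnW lt_ba) /= gtn_eqF // b_widen.
  rewrite UE coefM_low => [|j lt_jl].
    rewrite coef_poly lt_lk mxE ltnn coef_poly (leq_trans _ lt_lk) //; congr (_ * y _ _ _).
    exact: val_inj.
  rewrite coef_poly (ltn_trans lt_jl lt_lk); apply: y0; first exact: ltn_trans lt_jl lt_lk.
  + by rewrite /is_param gtn_min lt_bq orbT.
  + by rewrite /is_lower_param lt_ba le_bq ltn_eqF.
  + by rewrite eqxx lt_jl orbT.
- by move: le_bq; rewrite leqNgt lt_qb.
have lt_l : (l < k - i)%N by move: bq_l; rewrite eq_bq eqxx.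
have lt_qa : (q < a)%N by rewrite -eq_bq.
have le_il : (i <= l)%N.
  by move: par; rewrite /is_param eq_bq (minn_idPr (ltnW lt_qa)) ltnn eqxx /= orbF.
rewrite big1 ?add0r => [|p _]; last by rewrite U0 ?mul0r ?coef0 // eq_bq ltn_ord.
rewrite !coefXnM lt_l addr0 ltnNge le_il /=.
have b_ord : b = Ordinal lt_qn by apply: val_inj.
have uE : last_col y a 0 = \poly_(j < k - 2 * i) y a b (i + j)%N.
  by rewrite mxE ltnNge (ltnW lt_qa) /= gtn_eqF // -b_ord.
rewrite uE coefM_low => [|j lt_jl].
  rewrite coef_poly mxE [(b < q)%N](_ : _ = false) ?eq_bq ?ltnn // /= coef_poly addn0 subnKC //.
  have -> : (l - i < k - 2 * i)%N by lia.
  have -> : (0 < k - 2 * i)%N by lia.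
  by congr (_ * y _ _ _); apply: val_inj.
rewrite coef_poly; case: ltnP => // lt_j; apply: y0; first by lia.
- by rewrite /is_param eq_bq (minn_idPr (ltnW lt_qa)) eqxx leq_addr orbT.
- by rewrite /is_lower_param lt_ba le_bq eq_bq eqxx /=; lia.
- by rewrite eqxx; lia.
Qed.

Lemma triangular_param0 y : (forall (a : 'I_m) (b : 'I_n) l, (l < k)%N -> is_param k q i a b l -> y a b l = 0) ->
  forall a b, triangular_param y a b = 0.
Proof.
move=> y0 a b; rewrite triangular_paramE.
have V0 p : upper_factor y p b = 0.
  rewrite mxE; case: ltnP => // _; apply/polyP => j; rewrite coef_poly coef0.
  by case: ltnP => // lt_j; apply: y0; rewrite // /is_param gtn_min /= ltn_ord.
have v0 : last_row y 0 b = 0.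
  rewrite mxE; case: ltnP => // le_qb; apply/polyP => j; rewrite coef_poly coef0.
  case: ltnP => // lt_j; apply: y0; first by lia.
  by rewrite /is_param (minn_idPl _) //= eqxx leq_addr orbT.
have W0 : remainder y a b = 0.
  rewrite mxE; case: ifP => // /andP[le_qa le_qb]; apply/polyP => j; rewrite coef_poly coef0.
  case: ltnP => // lt_j; apply: y0; first by lia.
  rewrite /is_param; case: ltngtP => //= _; [by rewrite leq_addr | by rewrite orbF; lia].
by rewrite v0 W0 !mulr0 !addr0 big1 // => p _; rewrite V0 mulr0.
Qed.

End Ring.

Lemma triangular_param_map (R R' : comNzRingType) (f : {rmorphism R -> R'}) y a b :
  map_poly f (@triangular_param R y a b) = triangular_param (fun a b l => f (y a b l)) a b.
Proof.
have map_polyE N (E : nat -> R) : map_poly f (\poly_(l < N) E l) = \poly_(l < N) f (E l).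
  by apply/polyP => l; rewrite coef_map !coef_poly; case: ltnP => _ //; apply: raddf0.
rewrite !triangular_paramE !rmorphD rmorph_sum !rmorphM /= !map_polyXn; congr (_ + _ * (_ * _) + _ * _).
- apply: eq_bigr => p _; rewrite rmorphM !mxE /=; congr (_ * _).
    by case: ltngtP => _; rewrite ?rmorph0 ?rmorph1 ?map_polyE.
  by case: ltnP => _; rewrite ?rmorph0 ?map_polyE.
- by rewrite !mxE; case: ltngtP => _; rewrite ?rmorph0 ?rmorph1 ?map_polyE.
- by rewrite !mxE; case: ltnP => _; rewrite ?rmorph0 ?map_polyE.
- by rewrite !mxE; case: ifP => _; rewrite ?rmorph0 ?map_polyE.
Qed.

End TriangularParam.

(** * Primes obtained by killing parameters *)

Lemma horner_mmap (F : closedFieldType) (N : nat) (h : 'I_N -> {poly F}) (f : {mpoly F[N]}) (s : F) :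
  (mmap polyC h f).[s] = f.@[fun c => (h c).[s]].
Proof.
rewrite /meval /mmap horner_sum; apply: eq_bigr => mon _.
rewrite hornerM hornerC /=; congr (_ * _); rewrite /mmap1 horner_prod.
by apply: eq_bigr => c _; rewrite horner_exp.
Qed.

(** Restricted to the curve, both functions are nonzero polynomials in one variable; their product
    is nonzero, and an algebraically closed field contains a non-root of it. *)
Lemma polynomial_curves_prime (F : closedFieldType) (N : nat) (f g : {mpoly F[N]})
    (h : 'I_N -> {poly F}) (s1 s2 : F) :
  f.@[fun c => (h c).[s1]] != 0 -> g.@[fun c => (h c).[s2]] != 0 ->
  exists s, (f * g).@[fun c => (h c).[s]] != 0.
Proof.
rewrite -!horner_mmap => f0 g0.
have : mmap polyC h f * mmap polyC h g != 0.
  by rewrite mulf_eq0 negb_or; apply/andP; split;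
     [apply: contraNneq f0 => -> | apply: contraNneq g0 => ->]; rewrite horner0.
move=> /closed_nonrootP[s]; rewrite /root hornerM !horner_mmap -mevalM => fg0.
by exists s.
Qed.

Definition origin_ideal (F : closedFieldType) (N : nat) (f : {mpoly F[N]}) : Prop :=
  f.@[fun=> 0] = 0.

Section PrimeChain.
Variables (F : closedFieldType) (m n k q i : nat).
Variables (lt_qm : (q < m)%N) (lt_qn : (q < n)%N) (le_ik : (2 * i <= k)%N).
Implicit Types (y : 'I_m -> 'I_n -> nat -> F) (K : pred ('I_m * 'I_n * 'I_k)).

Definition triangular_point y : 'I_(nvars m n k) -> F :=
  mxpt (triangular_param k i lt_qm lt_qn y).

(** The ideal of the closure of the image of the coordinate subspace on which the parameters in [K]
    vanish. *)
Definition vanishing_ideal K (f : {mpoly F[nvars m n k]}) : Prop :=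
  forall y, (forall (a : 'I_m) (b : 'I_n) (l : 'I_k), K (a, b, l) -> y a b l = 0) -> f.@[triangular_point y] = 0.

(** Two parameter points are joined by a line inside the coordinate subspace; its image is a
    polynomial curve, on which a product of two functions not vanishing identically is somewhere
    nonzero. *)
Lemma vanishing_ideal_prime K : prime_over (@IZ F m n (q + 2) k) (vanishing_ideal K).
Proof.
split.
- split=> [y _|f g fK gK y yK|a f fK y yK]; first exact: meval0.
    by rewrite mevalD fK // gK // addr0.
  by rewrite mevalM fK // mulr0.
- by move=> f fZ y _; apply: fZ; apply: in_Z_low_rank.
- by move=> /(_ (fun _ _ _ => 0) (fun _ _ _ _ => erefl)) /eqP; rewrite meval1 oner_eq0.
move=> f g fgK; apply: NNPP => /not_or_and[/not_all_imply[y1 [y1K /eqP f1]] /not_all_imply[y2 [y2K /eqP g2]]].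
pose Y a b l : {poly F} := (y1 a b l)%:P + 'X * (y2 a b l - y1 a b l)%:P.
pose h (c : 'I_(nvars m n k)) : {poly F} :=
  let: (a, b, l) := enum_val c : 'I_m * 'I_n * 'I_k in
  (triangular_param k i lt_qm lt_qn Y a b)`_l.
have hE t c : (h c).[t] = triangular_point (fun a b l => (Y a b l).[t]) c.
  rewrite /h /triangular_point /mxpt; case: (enum_val c) => [[a b] l].
  by rewrite -(triangular_param_map k i lt_qm lt_qn (horner_eval t)) coef_map.
have YE t a b l : (Y a b l).[t] = y1 a b l + t * (y2 a b l - y1 a b l).
  by rewrite /Y !hornerE.
have point_eq t y : (forall a b l, (Y a b l).[t] = y a b l) ->
    forall p, p.@[triangular_point y] = p.@[fun c => (h c).[t]].
  move=> Yy p; apply: meval_eq => c; rewrite hE /triangular_point /mxpt.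
  case: (enum_val c) => [[a b] l]; congr (_`_l); rewrite !triangular_paramE.
  have Yy' : (fun a b l => (Y a b l).[t]) = y by do 3!apply: functional_extensionality => ?; apply: Yy.
  by rewrite Yy'.
have [||t] := @polynomial_curves_prime F _ f g h 0 1.
- by rewrite -(point_eq 0 y1) // => a b l; rewrite YE mul0r addr0.
- by rewrite -(point_eq 1 y2) // => a b l; rewrite YE mul1r addrC subrK.
rewrite -(point_eq t _ (fun a b l => erefl)) fgK ?eqxx // => a b l Kabl.
by rewrite YE y1K // y2K // subrr mulr0 addr0.
Qed.

(* Order in which the parameters are killed: first the subdiagonal entries of the lower factor,
   column by column. *)
Definition param_key (c : 'I_m * 'I_n * 'I_k) : nat :=
  if is_lower_param k q i c.1.2 c.1.1 c.2 then (c.1.2 * k + c.2)%N else (q.+1 * k)%N.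

Lemma param_key_lower (c : 'I_m * 'I_n * 'I_k) : is_lower_param k q i c.1.2 c.1.1 c.2 -> (param_key c < q.+1 * k)%N.
Proof.
rewrite /param_key => low; rewrite low; case/and3P: low => _ le_bq _.
by have := ltn_ord c.2; nia.
Qed.

(* If all parameters of smaller key vanish, the coordinate with index c is the parameter at c times
   a parameter (or 1) whose key is maximal. *)
Lemma vanishing_ideal_strict K c :
  c \in params m n k q i -> ~~ K c ->
  (forall c', c' \in params m n k q i -> (param_key c' < param_key c)%N -> K c') ->
  (forall c', K c' -> (param_key c' <= param_key c)%N) ->
  exists f, vanishing_ideal (predU1 c K) f /\ ~ vanishing_ideal K f.
Proof.
case: c => [[a b] l] par nK Kbelow Kle; rewrite inE /= in par.
have coordE y : ('X_(enum_rank (a, b, l))).@[triangular_point y] =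
    (triangular_param k i lt_qm lt_qn y a b)`_l by rewrite mevalXU /triangular_point mxptE.
exists 'X_(enum_rank (a, b, l)).
have [low|nlow] := boolP (is_lower_param k q i b a l); last first.
  have y0low y : (forall (a : 'I_m) (b : 'I_n) (l : 'I_k), K (a, b, l) -> y a b l = 0) ->
      (triangular_param k i lt_qm lt_qn y a b)`_l = y a b l.
    move=> yK; apply: triangular_param_linear => // a' b' l' lt_l' par' low'.
    apply: (yK a' b' (Ordinal lt_l')); apply: Kbelow; first by rewrite inE.
    by rewrite {2}/param_key (negPf nlow); apply: param_key_lower.
  (* The witness is the point whose only nonzero parameter is the one at [(a, b, l)]. *)
  split=> [y yK|/(_ (fun a' b' l' => (((a', b') == (a, b)) && (l' == l :> nat))%:R)) H].
    rewrite coordE y0low; first by apply: yK; rewrite /= eqxx.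
    by move=> a' b' l' Kl'; apply: yK; rewrite /= Kl' orbT.
  have y0 : forall (a' : 'I_m) (b' : 'I_n) (l' : 'I_k), K (a', b', l') -> (((a', b') == (a, b)) && (l' == l :> nat))%:R = 0 :> F.
    move=> a' b' l' Kc'; case: andP => // -[/eqP[ea eb] /eqP el]; case/negP: nK.
    by move: Kc'; rewrite ea eb (val_inj el).
  by move/eqP: (H y0); rewrite coordE y0low // !eqxx oner_eq0.
have [lt_ba le_bq bq_l] := and3P low; have lt_bm := leq_ltn_trans le_bq lt_qm.
pose e := if b == q :> nat then i else 0%N.
have yE y : (forall (a : 'I_m) (b : 'I_n) (l : 'I_k), K (a, b, l) -> y a b l = 0) ->
    (triangular_param k i lt_qm lt_qn y a b)`_l = y a b l * y (Ordinal lt_bm) b e.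
  move=> yK; apply: triangular_param_lower => // a' b' l' lt_l' par' low' lt_key.
  apply: (yK a' b' (Ordinal lt_l')); apply: Kbelow; first by rewrite inE.
  rewrite /param_key /= low low'; case/orP: lt_key => [lt_b|/andP[/eqP-> lt_l]]; last by rewrite ltn_add2l.
  by nia.
split=> [y yK|].
  rewrite coordE yE; first by rewrite (yK a b l) ?mul0r //= eqxx.
  by move=> a' b' l' Kl'; apply: yK; rewrite /= Kl' orbT.
(* The coordinate is a product of two parameters, so both are set to 1; the diagonal one has maximal
   key and hence is not in [K]. *)
pose y (a' : 'I_m) (b' : 'I_n) (l' : nat) : F := ((b' == b) &&
  (((a' == a) && (l' == l :> nat)) || ((a' == Ordinal lt_bm) && (l' == e :> nat))))%:R.
have yK : forall (a : 'I_m) (b : 'I_n) (l : 'I_k), K (a, b, l) -> y a b l = 0.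
  move=> a' b' l' Kc'; rewrite /y; case: eqP => // eb /=.
  case: orP => // -[/andP[/eqP ea /eqP el]|/andP[/eqP ea _]].
    by case/negP: nK; move: Kc'; rewrite ea eb (val_inj el).
  have := Kle _ Kc'; rewrite leqNgt; case/negP.
  rewrite {2}/param_key ea eb /is_lower_param /= ltnn /=.
  exact: param_key_lower.
move=> /(_ y yK) /eqP; rewrite coordE yE // /y !eqxx orbT /= mulr1.
by rewrite oner_eq0.
Qed.

(** Parameters are killed one by one in the order of [param_key], each giving a strict inclusion;
    once all are killed only the origin remains. *)
Lemma prime_chain_params :
  exists c, prime_chain_to (@IZ F m n (q + 2) k) (@origin_ideal F _) c #|params m n k q i|.
Proof.
pose s := sort (fun c c' => param_key c <= param_key c')%N (enum (params m n k q i)).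
have mem_s c : (c \in s) = (c \in params m n k q i) by rewrite mem_sort mem_enum.
have size_s : size s = #|params m n k q i| by rewrite size_sort cardE.
have s_uniq : uniq s by rewrite sort_uniq enum_uniq.
have s_sorted : sorted (fun c c' => param_key c <= param_key c')%N s.
  by apply: sort_sorted => c c'; apply: leq_total.
exists (fun j => vanishing_ideal (mem (take j s))); split; last split.
- by move=> j _; apply: vanishing_ideal_prime.
- move=> j lt_j; rewrite -size_s in lt_j; have [c0 s0] : exists c, c \in s.
    by case: (s) lt_j => // c ? _; exists c; rewrite inE eqxx.
  set c := nth c0 s j.
  have takeS : take j.+1 s =i predU1 c (mem (take j s)).
    by move=> c'; rewrite (take_nth c0 lt_j) mem_rcons inE.
  have key_le i1 i2 : (i1 <= i2)%N -> (i2 < size s)%N ->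
      (param_key (nth c0 s i1) <= param_key (nth c0 s i2))%N.
    move=> le12 lt2; apply: (sorted_leq_nth _ _ c0 s_sorted) => //; rewrite ?inE //.
    - by move=> ? ? ?; apply: leq_trans.
    - exact: leq_ltn_trans lt2.
  split=> [f fK y yK|].
    by apply: fK => a b l Kc; apply: yK; rewrite /= takeS /= inE /= [_ \in _]Kc orbT.
  have [||c' c's lt_key|c' c's|f [fS fK]] := @vanishing_ideal_strict (mem (take j s)) c.
  - by rewrite -mem_s mem_nth.
  - by rewrite /= in_take ?mem_nth // index_uniq // ltnn.
  - rewrite /= in_take ?mem_s // ltnNge; apply: contraL lt_key => le_j.
    rewrite -leqNgt -[c'](nth_index c0 (s := s)) ?mem_s //.
    by apply: key_le; rewrite // index_mem mem_s.
  - have c's' := mem_take c's; move: c's; rewrite /= in_take // => lt_i.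
    rewrite -[c'](nth_index c0 (s := s)) //; apply: key_le => //; exact: ltnW.
  exists f; split=> // y yK; apply: fS => a b l Kc; apply: yK.
  by rewrite /= takeS.
have point0 y : (forall a b (l : 'I_k), (a, b, l) \in s -> y a b l = 0) ->
    triangular_point y =1 (fun=> 0).
  move=> y0 c; rewrite /triangular_point /mxpt; case: (enum_val c) => [[a b] l].
  rewrite triangular_param0 ?coef0 // => a' b' l' lt_l' par.
  by apply: (y0 a' b' (Ordinal lt_l')); rewrite mem_s inE.
rewrite -size_s take_size => f; split=> [fs|f0 y yK].
  rewrite /origin_ideal -(meval_eq f (point0 (fun _ _ _ => 0) (fun _ _ _ _ => erefl))).
  exact: fs.
by rewrite (meval_eq f (point0 y yK)).
Qed.

End PrimeChain.

(** * The local ring at the origin *)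

Lemma IZ_ideal (F : closedFieldType) (m n r k : nat) : is_ideal (@IZ F m n r k).
Proof.
split=> [x _|f g fZ gZ x xZ|a f fZ x xZ]; first exact: meval0.
- by rewrite mevalD fZ // gZ // addr0.
- by rewrite mevalM fZ // mulr0.
Qed.

(* Z is a cone, so a function that is nonzero somewhere on Z is nonzero in the local ring at 0. *)
Lemma nonzero_at_origin (F : closedFieldType) (m n r k : nat) (z : {mpoly F[nvars m n k]}) x :
  in_Z r x -> z.@[x] != 0 -> ~ saturation (@origin_ideal F _) (@IZ F m n r k) z.
Proof.
move=> xZ z0 [u [/eqP u0 uzZ]]; pose h c : {poly F} := x c *: 'X.
have hE s c : (h c).[s] = s * x c by rewrite hornerZ hornerX mulrC.
have [||s] := @polynomial_curves_prime F _ u z h 0 1.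
- by rewrite (meval_eq u (_ : _ =1 fun=> 0)) // => c; rewrite hE mul0r.
- by rewrite (meval_eq z (_ : _ =1 x)) // => c; rewrite hE mul1r.
by rewrite (meval_eq _ (hE s)) uzZ ?eqxx //; apply: in_Z_scale.
Qed.

Lemma origin_maximal (F : closedFieldType) (m n r k : nat) x :
  @in_Z F m n r k x -> maximal_over (@IZ F m n r k) (@origin_ideal F _).
Proof.
move=> xZ; split; first split.
- split=> [|f g f0 g0|a f f0]; rewrite /origin_ideal ?meval0 //.
  + by rewrite mevalD f0 g0 addr0.
  + by rewrite mevalM f0 mulr0.
- move=> f fZ; rewrite /origin_ideal -[RHS](fZ _ (in_Z_scale 0 xZ)).
  by apply: meval_eq => c; rewrite mul0r.
- by rewrite /origin_ideal meval1 => /eqP; rewrite oner_eq0.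
- move=> f g; rewrite /origin_ideal mevalM => /eqP; rewrite mulf_eq0.
  by case/orP=> /eqP f0; [left | right].
move=> Q Qid MQ Q1 f Qf; apply: NNPP => /eqP f0; have [_ addQ mulQ] := Qid; apply: Q1.
set c := f.@[fun=> 0] in f0.
have Qc : Q c%:MP.
  have -> : c%:MP = f - (f - c%:MP) by rewrite opprB addrC subrK.
  by apply: ideal_sub => //; apply: MQ; rewrite /origin_ideal mevalB mevalC subrr.
by have := mulQ (c^-1)%:MP _ Qc; rewrite -mpolyCM mulVf.
Qed.

(** * Test functions and test points for the two components *)

Lemma det_mx22 (R : comNzRingType) (A : 'M[R]_2) :
  \det A = A 0 0 * A 1 1 - A 0 1 * A 1 0.
Proof.
rewrite (expand_det_row A 0) big_ord_recl big_ord1 /cofactor !det_mx11 !mxE /=.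
rewrite !expr0 mul1r expr1 mulN1r mulrN; congr (_ * A _ _ - A _ _ * A _ _); exact: val_inj.
Qed.

Lemma corner_proof (q p : nat) (a : 'I_3) : (q + 3 <= p)%N -> (q + a < p)%N.
Proof. by apply: leq_trans; rewrite ltn_add2l. Qed.

Section Components.
Variables (F : closedFieldType) (m n k q : nat) (lt_qm : (q < m)%N) (lt_qn : (q < n)%N).
Variables (le_qm : (q + 3 <= m)%N) (le_qn : (q + 3 <= n)%N).
Implicit Types x : 'I_(nvars m n k) -> F.

Local Notation f0 := (widen_ord (ltnW lt_qm)).
Local Notation g0 := (widen_ord (ltnW lt_qn)).
Local Notation qm := (Ordinal lt_qm).
Local Notation qn := (Ordinal lt_qn).

Definition corner_row (a : 'I_3) : 'I_m := Ordinal (corner_proof a le_qm).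
Definition corner_col (a : 'I_3) : 'I_n := Ordinal (corner_proof a le_qn).

(** Leading minors of sizes [q], [q + 1] and [q + 3]; the latter two are written with [catf] so that
    [det_schur] applies. *)
Definition minor_q (R : comNzRingType) (X : 'M[R]_(m, n)) := \det (mxsub f0 g0 X).
Definition minor_q1 (R : comNzRingType) (X : 'M[R]_(m, n)) :=
  \det (mxsub (catf f0 (fun _ : 'I_1 => qm)) (catf g0 (fun _ : 'I_1 => qn)) X).
Definition minor_q3 (R : comNzRingType) (X : 'M[R]_(m, n)) :=
  \det (mxsub (catf f0 corner_row) (catf g0 corner_col) X).

Local Notation Y x := (schur f0 g0 (ptmx x)).

Lemma schur_pivot x : (minor_q (ptmx x))`_0 != 0 -> Y x qm qn = minor_q1 (ptmx x).
Proof.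
move=> d0; have nz : minor_q (ptmx x) != 0 by apply: contraNneq d0 => ->; rewrite coef0.
have := det_schur f0 g0 (ptmx x) (fun _ : 'I_1 => qm) (fun _ : 'I_1 => qn).
rewrite expr1 mulrC => /(mulfI nz); rewrite /minor_q1 => ->.
by rewrite det_mx11 [RHS]mxE.
Qed.

Lemma schur_minor2 x (f : 'I_2 -> 'I_m) (g : 'I_2 -> 'I_n) :
  in_Z (q + 2) x -> (minor_q (ptmx x))`_0 != 0 ->
  {homo f : a b / (a < b)%N} -> {homo g : a b / (a < b)%N} ->
  (forall a, (q <= f a)%N) -> (forall a, (q <= g a)%N) ->
  'X^k %| \det (mxsub f g (Y x)).
Proof.
move=> /in_ZP xZ d0 fh gh qf qg.
rewrite -(Gauss_dvdpr _ (coprimep_Xn k d0)) /minor_q -det_schur dvdp_mulr // xZ //.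
  by apply: catf_homo => // a b; apply: leq_trans (qf b); rewrite /= ltn_ord.
by apply: catf_homo => // a b; apply: leq_trans (qg b); rewrite /= ltn_ord.
Qed.

Lemma dvdp_minor_q3 x : in_Z (q + 2) x -> (minor_q (ptmx x))`_0 != 0 ->
  (exists a b, (Y x (corner_row a) (corner_col b))`_0 != 0) -> 'X^(2 * k) %| minor_q3 (ptmx x).
Proof.
move=> xZ d0 [a [b Yab]].
have : 'X^(2 * k) %| \det (mxsub corner_row corner_col (Y x)).
  apply: dvdp_det3 => [c d|]; last by exists a, b; rewrite mxE.
  have -> : row' c (col' d (mxsub corner_row corner_col (Y x))) =
      mxsub (corner_row \o lift c) (corner_col \o lift d) (Y x).
    by apply/matrixP => e e'; rewrite !mxE.
  apply: schur_minor2 => //= e; rewrite ?leq_addr //.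
    by move=> e' lt_e; rewrite ltn_add2l /= /bump; case: (leqP c e) (leqP c e') => ? [] ?; lia.
  by move=> e' lt_e; rewrite ltn_add2l /= /bump; case: (leqP d e) (leqP d e') => ? [] ?; lia.
rewrite -(Gauss_dvdpr _ (coprimep_Xn (2 * k) d0)) /minor_q -det_schur Gauss_dvdpl //.
by apply: coprimep_expr; apply: coprimep_Xn.
Qed.

Definition component_test (i : nat) : {mpoly F[nvars m n k]} :=
  (minor_q (Xt F m n k))`_0 * (minor_q1 (Xt F m n k))`_i.

(** The last coefficient that must vanish when the corner of the Schur complement has a nonzero
    constant term. *)
Definition corner_test : {mpoly F[nvars m n k]} := (minor_q3 (Xt F m n k))`_(2 * k).-1.

Lemma component_test_eval i x :
  (component_test i).@[x] = (minor_q (ptmx x))`_0 * (minor_q1 (ptmx x))`_i.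
Proof. by rewrite mevalM !minor_meval. Qed.

Lemma corner_test_eval x : corner_test.@[x] = (minor_q3 (ptmx x))`_(2 * k).-1.
Proof. exact: minor_meval. Qed.

Lemma corner_test_vanish x : (0 < k)%N -> in_Z (q + 2) x -> (minor_q (ptmx x))`_0 != 0 ->
  corner_test.@[x] != 0 -> forall a b, (Y x (corner_row a) (corner_col b))`_0 = 0.
Proof.
move=> k0 xZ d0 t0 a b; apply/eqP; apply: contraNT t0 => Yab.
rewrite corner_test_eval; apply/eqP; have := dvdp_minor_q3 xZ d0 (ex_intro _ a (ex_intro _ b Yab)).
by move=> /dvdXnP; apply; lia.
Qed.

(** Where the pivot minor has nonzero constant term and [corner_test] is nonzero, the corner of the
    Schur complement has zero constant term. Its first entry is [minor_q1], so [component_test 0]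
    vanishes there. *)
Lemma test_product_IZ : (0 < k)%N ->
  @IZ F m n (q + 2) k (component_test 0 * (component_test 1 * corner_test)).
Proof.
move=> k0 x xZ; rewrite mevalM [X in _ * X]mevalM !component_test_eval.
have [->|d0] := eqVneq (minor_q (ptmx x))`_0 0; first by rewrite !mul0r.
have [->|t0] := eqVneq corner_test.@[x] 0; first by rewrite !mulr0.
rewrite -schur_pivot //; have := corner_test_vanish k0 xZ d0 t0 ord0 ord0.
have -> : corner_row ord0 = qm by apply: val_inj; rewrite /= addn0.
have -> : corner_col ord0 = qn by apply: val_inj; rewrite /= addn0.
by move=> ->; rewrite mulr0 !mul0r.
Qed.

Lemma component_cover i x (p : {mpoly F[nvars m n k]}) :
  (2 * i <= k)%N -> in_Z (q + 2) x -> (component_test i).@[x] != 0 ->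
  (forall (a : 'I_m) (b : 'I_n), (q <= a)%N -> (q <= b)%N -> 'X^i %| Y x a b) ->
  p \mPo @block_tuple m n k q i lt_qm lt_qn F = 0 -> p.@[x] = 0.
Proof.
move=> le_ik xZ; rewrite component_test_eval mulf_eq0 negb_or => /andP[d0 Yqq] Yi p0.
have [|a b lt_qa lt_qb|y yP] := block_cover (X := ptmx x) le_ik d0 Yi.
- by rewrite schur_pivot.
- pose f (j : 'I_2) := if j == ord0 then qm else a.
  pose g (j : 'I_2) := if j == ord0 then qn else b.
  have := @schur_minor2 x f g xZ d0; rewrite det_mx22 !mxE /f /g /=; apply.
  + by case=> [[|[|//]] ?] [[|[|//]] ?].
  + by case=> [[|[|//]] ?] [[|[|//]] ?].
  + by case=> [[|[|//]] ?] //=; apply: ltnW.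
  + by case=> [[|[|//]] ?] //=; apply: ltnW.
exact: (block_tuple_vanish le_ik yP p0).
Qed.

(** For [i = 1] the first [q + 3] entries multiply to ['X^(2 * k - 1)], the degree read by
    [corner_test]; for [i = 0] the factor [i%:R] switches off the last two. *)
Definition diagonal_entry (i a : nat) : {poly F} :=
  if (a < q)%N then 1 else if a == q then 'X^i else
  if (a <= q + 2)%N then i%:R *: 'X^(k.-1) else 0.

Definition diagonal_point i : 'I_(nvars m n k) -> F :=
  mxpt (\matrix_(a, b) if a == b :> nat then diagonal_entry i a else 0).

Lemma diagonal_point_in_Z i : (i <= 1)%N -> (2 * i <= k)%N -> in_Z (q + 2) (diagonal_point i).
Proof.
move=> le_i1 le_ik; rewrite /diagonal_point.
pose U : 'M[{poly F}]_(m, q) := \matrix_(a, p) (a == p :> nat)%:R.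
pose V : 'M[{poly F}]_(q, n) := \matrix_(p, b) (p == b :> nat)%:R.
pose u : 'cV[{poly F}]_m := \col_a (a == q :> nat)%:R.
pose v : 'rV[{poly F}]_n := \row_b (b == q :> nat)%:R.
pose W : 'M[{poly F}]_(m, n) := \matrix_(a, b)
  ((q < a)%N && (a <= q + 2)%N && (a == b :> nat) && (i == 1%N))%:R.
have -> : \matrix_(a, b) (if a == b :> nat then diagonal_entry i a else 0) =
    U *m V + 'X^i *: (u *m v) + 'X^(k - i) *: W :> 'M_(m, n).
  apply/matrixP => a b; rewrite !mxE big_ord1 !mxE.
  have -> : \sum_p U a p * V p b = ((a == b :> nat) && (a < q)%N)%:R.
    have [lt_aq|le_qa] := ltnP a q.
      rewrite (bigD1 (Ordinal lt_aq)) //= !mxE eqxx mul1r andbT big1 ?addr0 // => p ne_p.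
      rewrite !mxE; case: eqP => [ap|_]; last by rewrite mul0r.
      by case/eqP: ne_p; apply: val_inj.
    rewrite andbF big1 // => p _; rewrite !mxE gtn_eqF ?mul0r //.
    exact: leq_trans (ltn_ord p) le_qa.
  rewrite /diagonal_entry; have [<-|ne_ab] := eqVneq (a : nat) b; last first.
    have -> : (a == q :> nat)%:R * (b == q :> nat)%:R = 0 :> {poly F}.
      case: (eqVneq (a : nat) q) ne_ab => [->|_ _]; last by rewrite mul0r.
      by rewrite eq_sym => /negPf->; rewrite mulr0.
    by rewrite !andbF /= !mulr0 !addr0.
  case: (ltnP a q) => [lt_aq|]; first by rewrite ltn_eqF // ltnNge (ltnW lt_aq) !mulr0 !addr0.
  rewrite leq_eqVlt => /orP[/eqP<-|lt_qa]; first by rewrite eqxx ltnn !mulr1 mulr0 addr0 add0r.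
  rewrite gtn_eqF // lt_qa !mulr0 !add0r.
  case: leqP => _; rewrite /= ?mulr0 //.
  have /orP[] : (i == 0%N) || (i == 1%N) by lia.
    by move=> /eqP->; rewrite /= mulr0 scale0r.
  by move=> /eqP->; rewrite eqxx mulr1 scale1r subn1.
exact: in_Z_low_rank.
Qed.

Lemma diagonal_minor i s (f : 'I_s -> 'I_m) (g : 'I_s -> 'I_n) : (i < k)%N ->
  (forall a, f a = a :> nat) -> (forall a, g a = a :> nat) ->
  \det (mxsub f g (ptmx (diagonal_point i))) = \prod_(a < s) diagonal_entry i a.
Proof.
move=> lt_ik fE gE; pose d : 'rV[{poly F}]_s := \row_a diagonal_entry i a.
have -> : mxsub f g (ptmx (diagonal_point i)) = diag_mx d.
  apply/matrixP => a b; rewrite mxE [RHS]mxE [d _ _]mxE.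
  apply/polyP => l; have [le_kl|lt_lk] := leqP k l.
    rewrite coef_ptmx_ge // coefMn; suff -> : (diagonal_entry i a)`_l = 0 by rewrite mul0rn.
    rewrite /diagonal_entry; case: ifP => _; first by rewrite coef1 gtn_eqF //; lia.
    case: ifP => _; first by rewrite coefXn gtn_eqF //; lia.
    by case: ifP => _; rewrite ?coef0 // coefZ coefXn gtn_eqF ?mulr0 //; lia.
  have := coef_ptmx (diagonal_point i) (f a) (g b) (Ordinal lt_lk) => /= ->.
  rewrite /diagonal_point mxptE mxE fE gE -val_eqE.
  by case: eqP => _; rewrite ?mulr1n ?mulr0n ?coef0.
by rewrite det_diag; apply: eq_bigr => a _; rewrite mxE.
Qed.

Lemma catf_val p s M (f : 'I_p -> 'I_M) (g : 'I_s -> 'I_M) :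
  (forall a, f a = a :> nat) -> (forall a, g a = p + a :> nat)%N ->
  forall a, catf f g a = a :> nat.
Proof. by move=> fE gE a; rewrite /catf; case: (splitP a) => b ->. Qed.

Lemma diagonal_prefix i : \prod_(a < q) diagonal_entry i a = 1.
Proof. by apply: big1 => a _; rewrite /diagonal_entry ltn_ord. Qed.

Lemma diagonal_test i : (i < k)%N -> (component_test i).@[diagonal_point i] != 0.
Proof.
move=> lt_ik; rewrite component_test_eval mulf_neq0 //.
  by rewrite /minor_q diagonal_minor // diagonal_prefix coef1 oner_eq0.
rewrite /minor_q1 diagonal_minor //; [|apply: catf_val => // a; rewrite ord1 addn0 //..].
rewrite big_split_ord /= diagonal_prefix mul1r big_ord1 /= addn0 /diagonal_entry ltnn eqxx.
by rewrite coefXn eqxx oner_eq0.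
Qed.

Lemma diagonal_corner_test : (1 < k)%N -> corner_test.@[diagonal_point 1] != 0.
Proof.
move=> lt_1k; rewrite corner_test_eval /minor_q3 diagonal_minor //;
  [|exact: catf_val|exact: catf_val].
rewrite big_split_ord /= diagonal_prefix mul1r !big_ord_recl big_ord0 /= /bump /= mulr1.
have -> : diagonal_entry 1 (q + 0) = 'X by rewrite /diagonal_entry addn0 ltnn eqxx expr1.
have last_entry j : (0 < j <= 2)%N -> diagonal_entry 1 (q + j) = 'X^(k.-1).
  move=> /andP[j0 j2]; rewrite /diagonal_entry ltnNge leq_addr /= gtn_eqF; last by lia.
  by rewrite leq_add2l j2 scale1r.
rewrite !last_entry // -exprD -exprS coefXn.
have -> : (2 * k).-1 = (k.-1 + k.-1).+1 by lia.
by rewrite eqxx oner_eq0.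
Qed.

End Components.

(** * Failure of normality, and depth against dimension *)

Theorem theorem6p2 (F : closedFieldType) (m n r k : nat) :
  (2 <= r)%N -> (r < m)%N -> (m <= n)%N -> (2 <= k)%N ->
  ~ normal_ring (@IZ F m n r k) /\
  ((m, n) <> (r.+1, r.+2) -> ~ CohenMacaulay (@IZ F m n r k)).
Proof.
move=> r2; have [q ->] : exists q, r = (q + 2)%N by exists (r - 2)%N; rewrite subnK.
move=> {r r2} lt_rm le_mn k2.
have le_qm : (q + 3 <= m)%N by lia.
have le_qn : (q + 3 <= n)%N by lia.
have lt_qm : (q < m)%N by lia.
have lt_qn : (q < n)%N by lia.
have k0 : (0 < k)%N by lia.
pose x i : 'I_(nvars m n k) -> F := diagonal_point F q i.
have xZ i : (i <= 1)%N -> in_Z (q + 2) (x i) by move=> i1; apply: diagonal_point_in_Z => //; lia.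
pose z0 := component_test F k lt_qm lt_qn 0.
pose z1 := component_test F k lt_qm lt_qn 1 * corner_test F k lt_qm lt_qn le_qm le_qn.
have z0x : z0.@[x 0%N] != 0 by apply: diagonal_test.
have z1x : z1.@[x 1%N] != 0.
  by rewrite mevalM mulf_neq0 //; [apply: diagonal_test | apply: diagonal_corner_test].
have nz0 := nonzero_at_origin (xZ 0%N isT) z0x; have nz1 := nonzero_at_origin (xZ 1%N isT) z1x.
have Mmax := origin_maximal (xZ 0%N isT); have [Mprime _] := Mmax.
split=> [normal|neq_mn CM].
  (* Normality would make the local ring a domain, but [z0 * z1] is zero there and neither factor
     is. *)
  have [_ [domain _]] := normal _ Mprime.
  have /domain[/nz0//|/nz1//] : loc_zero (@IZ F m n (q + 2) k) (@origin_ideal F _) (z0 * z1).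
  exists 1; split; first by case: Mprime.
  by rewrite mul1r; apply: test_product_IZ.
have [d [[s [size_s sreg]] _ _ dim_le]] := CM _ Mmax.
have le_params i : (2 * i <= k)%N -> (#|params m n k q i| <= size s)%N.
  by move=> le_ik; have [c cP] := prime_chain_params F lt_qm lt_qn le_ik; rewrite size_s; apply: dim_le cP.
have card_eq := card_params_diff k2 lt_qm lt_qn.
have bound i z : (2 * i <= k)%N -> ~ saturation (@origin_ideal F _) (@IZ F m n (q + 2) k) z ->
    (forall p x', p \mPo @block_tuple m n k q i lt_qm lt_qn F = 0 -> in_Z (q + 2) x' ->
       z.@[x'] != 0 -> p.@[x'] = 0) -> (size s <= #|params m n k q i|)%N.
  move=> le_ik nz cover; apply: (regular_sequence_bound (phi := @block_tuple m n k q i lt_qm lt_qn F)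
    (@IZ_ideal F m n (q + 2) k) Mprime nz _ sreg) => p p0 x' x'Z.
  rewrite mevalM; have [->|z_x'] := eqVneq z.@[x'] 0; first by rewrite mulr0.
  by rewrite (cover p x' p0 x'Z z_x') mul0r.
(* For [m = n = q + 3], component 1 has one parameter fewer than component 0: the former bounds the
   depth, the latter gives the long chain. *)
have [/andP[/eqP em /eqP en]|neq33] := boolP ((m == q + 3) && (n == q + 3))%N.
  suff : (size s <= #|params m n k q 1|)%N.
    have := le_params 0%N isT; move: card_eq.
    have [-> -> -> ->] : [/\ m - q = 3, n - q = 3, m - q.+1 = 2 & n - q.+1 = 2]%N by split; lia.
    by move: (#|params m n k q 1|) (#|params m n k q 0|) (size s) => e1 e0 sz; lia.
  apply: (bound 1%N z1) => // p x' p0 x'Z; rewrite mevalM mulf_eq0 negb_or => /andP[t1 tc].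
  apply: (component_cover _ x'Z t1 _ p0) => // a b le_qa le_qb; apply/dvdXnP => -[|//] _.
  (* In this size the 3 x 3 corner is the whole Schur complement outside the first [q] rows and
     columns, so [corner_test] controls every entry. *)
  have lt_a3 : (a - q < 3)%N by have := ltn_ord a; lia.
  have lt_b3 : (b - q < 3)%N by have := ltn_ord b; lia.
  have d0 : (minor_q lt_qm lt_qn (ptmx x'))`_0 != 0.
    by apply: contraNneq t1 => d0; rewrite component_test_eval d0 mul0r.
  have := corner_test_vanish k0 x'Z d0 tc (Ordinal lt_a3) (Ordinal lt_b3).
  have -> : corner_row le_qm (Ordinal lt_a3) = a by apply: val_inj; rewrite /= subnKC.
  by have -> : corner_col le_qn (Ordinal lt_b3) = b by apply: val_inj; rewrite /= subnKC.
(* The roles are now exchanged: with [m = q + 3 + a] and [n = q + 3 + b], component 1 exceeds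
   component 0 by [(a + 1) * (b + 1) - 2], positive in the remaining cases. *)
suff : (size s <= #|params m n k q 0|)%N.
  have := le_params 1%N; move: card_eq.
  have neq34 : ~~ ((m == q + 3) && (n == q + 4))%N.
    by apply: contra_notN neq_mn => /andP[/eqP-> /eqP->]; congr (_, _); lia.
  have [a em] : exists a, m = (q + 3 + a)%N by exists (m - (q + 3))%N; rewrite subnKC.
  have [b en] : exists b, n = (q + 3 + b)%N by exists (n - (q + 3))%N; rewrite subnKC.
  have [-> -> -> ->] : [/\ m - q = a + 3, n - q = b + 3, m - q.+1 = a + 2 & n - q.+1 = b + 2]%N.
    by split; lia.
  move: (#|params m n k q 1|) (#|params m n k q 0|) (size s) => e1 e0 sz card_eq /(_ k2) le1 le0.
  have : (a = 0 /\ 2 <= b \/ 1 <= a /\ 1 <= b)%N by lia.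
  by nia.
apply: (bound 0%N z0) => // p x' p0 x'Z t0.
by apply: (component_cover _ x'Z t0 _ p0) => // a b _ _; rewrite expr0 dvd1p.
Qed.
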